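(* Let $S(\omega,\underline{x})=(\theta\omega,\sigma\underline{x})$ be a random subshift of finite type on $\mathcal{E}\subset\Omega\times X$, with $S$-invariant probability measure $\nu$ with marginal $\mathbb{P}$ on $\Omega$, sample measures $(\mu_\omega)_\omega$ and marginal $\mu$ on $X$, and let $h=h_\nu(S,\Omega\times\mathcal{F}_0^1)$ (all as defined in the context). Assume that there are constants $h_0$ with $h\ge h_0>0$, $c>0$, $C_0>0$, $p\in(0,1]$, $q>\frac{h}{h_0}\left(1+\frac{3}{p}\right)$, a random variable $C\in L^p(\Omega,\mathbb{P})$ and a function $\alpha$ with $\alpha(g)g^q\to0$ as $g\to+\infty$, such that for all positive integers $m,n,g$, all $A\in\mathcal{F}_0^n$ and all $B\in\mathcal{F}_0^m$: (I) $\left|\mu(A\cap\sigma^{-g-n}B)-\mu(A)\mu(B)\right|\le C_0\,\alpha(g)$; (II) for $\mathbb{P}$-almost every $\omega\in\Omega$, $\mu_\omega(C^n(\underline{y}))\le c\,e^{-h_0 n}$ for any $\underline{y}\in X$ and $n\ge1$; (III) for $\mathbb{P}$-almost every $\omega\in\Omega$, $\left|\mu_\omega(A\cap\sigma^{-g-n}B)-\mu_\omega(A)\mu_{\theta^{n+g}\omega}(B)\right|\le C(\omega)\,\alpha(g)$. Then for $\mu$-almost every $\underline{y}$, $\mathbb{P}$-almost every $\omega$ and all $t\ge0$, $$\mu_\omega\left(\underline{x}\in X\colon R_n(\underline{x},\underline{y})>\frac{t}{\mu(C^n(\underline{y}))}\right)\to e^{-t}\quad\text{as } n\to\infty.$$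
   Context: Random subshift of finite type: $(\Omega,\theta,\mathbb{P})$ is an invertible ergodic probability measure preserving system, $X=\mathbb{N}^{\mathbb{N}}$ and $\sigma:X\to X$ is the (left) shift. $b:\Omega\to\mathbb{N}$ is a random variable with values in the positive integers such that $\mathbb{E}(\log b)<\infty$. $\{A(\omega)=(a_{ij}(\omega)):\omega\in\Omega\}$ is a random transition matrix: $A(\omega)$ is a $b(\omega)\times b(\theta\omega)$ matrix with entries in $\{0,1\}$, with at least one non-zero entry in each row and each column, and each $\omega\mapsto a_{ij}(\omega)$ is measurable. Put $X_\omega=\{1,\dots,b(\omega)\}$, $$\mathcal{E}_\omega=\{\underline{x}=(x_0,x_1,\dots)\colon x_i\in X_{\theta^i\omega}\text{ and }a_{x_ix_{i+1}}(\theta^i\omega)=1\text{ for all }i\ge0\}\subset X,$$ $$\mathcal{E}=\{(\omega,\underline{x})\colon\omega\in\Omega,\ \underline{x}\in\mathcal{E}_\omega\}\subset\Omega\times X,$$ and $S:\mathcal{E}\to\mathcal{E}$, $S(\omega,\underline{x})=(\theta\omega,\sigma\underline{x})$. $\nu$ is an $S$-invariant probability measure with marginal $\mathbb{P}$ on $\Omega$; $(\mu_\omega)_\omega$ (the sample measures) is its decomposition on the fibers $\mathcal{E}_\omega$, i.e. $d\nu(\omega,\underline{x})=d\mu_\omega(\underline{x})\,d\mathbb{P}(\omega)$, each $\mu_\omega$ being regarded as a measure on $X$; $\mu=\int\mu_\omega\,d\mathbb{P}(\omega)$ is the marginal of $\nu$ on $X$. For $\underline{y}\in X$, $C^n(\underline{y})=\{\underline{z}\in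 X\colon z_i=y_i,\ 0\le i\le n-1\}$ is the $n$-cylinder containing $\underline{y}$, and $\mathcal{F}_0^n$ is the sigma-algebra on $X$ generated by all $n$-cylinders. $h=h_\nu(S,\Omega\times\mathcal{F}_0^1)$ is the metric entropy of $S$ with respect to $\nu$ and the countable partition of $\mathcal{E}$ according to the value of $x_0$; it is finite since $\mathbb{E}(\log b)<\infty$. For $A\subset X$ the hitting time is $R(\underline{x},A)=\inf\{k\ge1\colon\sigma^k\underline{x}\in A\}$, and $R_n(\underline{x},\underline{y})=R(\underline{x},C^n(\underline{y}))$. *)

(* Defs.v *)
From HB Require Import structures.
From mathcomp Require Import all_boot all_order all_algebra.
From mathcomp Require Import all_classical all_reals all_analysis.

Set Implicit Arguments.
Unset Strict Implicit.
Unset Printing Implicit Defensive.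

Import Order.TTheory GRing.Theory Num.Theory.
Import numFieldNormedType.Exports.

Local Open Scope classical_set_scope.
Local Open Scope ring_scope.

Definition cylinder (n : nat) (y : nat -> nat) : set (nat -> nat) :=
  [set z | forall i, (i < n)%N -> z i = y i].

Definition n_cylinders (n : nat) : set (set (nat -> nat)) := range (cylinder n).

Definition cylinders : set (set (nat -> nat)) := \bigcup_n n_cylinders n.

(* The alphabet is all of [nat]; the symbols actually used are 1, ..., b(w),
   see [fiber]. *)
Definition symb := g_sigma_algebraType cylinders.
HB.instance Definition _ := Measurable.on symb.

Definition cyl_sigma (n : nat) : set (set symb) := <<s n_cylinders n >>.

Definition left_shift (x : symb) : symb := fun i => x i.+1.

(* inf {k >= 1 | left_shift^k x \in A}, equal to +oo if the orbit of x never
   enters A. *)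
Definition hitting_time (R : realType) (x : symb) (A : set symb) : \bar R :=
  ereal_inf
    [set k%:R%:E | k in [set k | (0 < k)%N /\ A (iter k left_shift x)]].

Section dynamics.
Context d (T : measurableType d) (R : realType).
Implicit Types (nu : {measure set T -> \bar R}) (S : T -> T).

Definition invariant_measure S nu :=
  forall A, measurable A -> nu (S @^-1` A) = nu A.

Record invertible_ergodic (P : probability T R) S : Prop := {
  ie_measurable : measurable_fun setT S ;
  ie_inverse : exists S' : T -> T,
    [/\ measurable_fun setT S', cancel S S' & cancel S' S] ;
  ie_invariant : invariant_measure S P ;
  ie_ergodic : forall A, measurable A -> S @^-1` A = A ->
    P A = 0%E \/ P A = 1%E }.

(* A countable partition is given by its label function [xi : T -> nat]; the
   atoms of the join of S^{-i} xi, i < n, are indexed by words of length n. *)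
Definition itinerary S (xi : T -> nat) (n : nat) (w : n.-tuple nat) : set T :=
  [set z | forall i : 'I_n, xi (iter i S z) = tnth w i].

Definition block_entropy nu S (xi : T -> nat) (n : nat) : \bar R :=
  \esum_(w in [set: n.-tuple nat])
    (- (fine (nu (itinerary S xi w)) * ln (fine (nu (itinerary S xi w)))))%:E.

Definition metric_entropy nu S (xi : T -> nat) : \bar R :=
  limn (fun n => block_entropy nu S xi n * (n%:R^-1)%:E)%E.

End dynamics.

Section random_subshift.
Context d (Omega : measurableType d) (R : realType).
Implicit Types (P : probability Omega R) (theta : Omega -> Omega).
Implicit Types (b : Omega -> nat) (a : Omega -> nat -> nat -> bool).

(* [a w i j] is only meaningful for 1 <= i <= b w and 1 <= j <= b (theta w);
   its other values are unconstrained and never used. *)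
Record random_transition_matrix P theta b a : Prop := {
  rtm_b_measurable : measurable_fun setT b ;
  rtm_b_gt0 : forall w, (0 < b w)%N ;
  rtm_b_log : P.-integrable setT (fun w => (ln (b w)%:R)%:E) ;
  rtm_a_measurable : forall i j, (0 < i)%N -> (0 < j)%N ->
    measurable_fun [set w | (i <= b w)%N && (j <= b (theta w))%N]
      (fun w => a w i j) ;
  rtm_row : forall w i, (1 <= i <= b w)%N ->
    exists2 j, (1 <= j <= b (theta w))%N & a w i j ;
  rtm_col : forall w j, (1 <= j <= b (theta w))%N ->
    exists2 i, (1 <= i <= b w)%N & a w i j }.

Definition fiber theta b a (w : Omega) : set symb :=
  [set x | forall i, (1 <= x i <= b (iter i theta w))%N /\
                     a (iter i theta w) (x i) (x i.+1)].

Definition bundle theta b a : set (Omega * symb) :=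
  [set z | fiber theta b a z.1 z.2].

(* S is extended to the whole product; it preserves the bundle. *)
Definition skew_product theta (z : Omega * symb) : Omega * symb :=
  (theta z.1, left_shift z.2).

(* A probability measure on the bundle is seen as a probability measure on
   the product giving full mass to the bundle. *)
Record invariant_on_bundle P theta b a
    (nu : probability (Omega * symb)%type R) : Prop := {
  iob_bundle : nu (bundle theta b a) = 1%E ;
  iob_invariant : invariant_measure (skew_product theta) nu ;
  iob_marginal : forall A, measurable A -> nu (fst @^-1` A) = P A }.

Record sample_measures P theta b a (nu : probability (Omega * symb)%type R)
    (mu_ : R.-pker Omega ~> symb) : Prop := {
  sm_disintegration : forall B, measurable B ->
    nu B = (\int[P]_w mu_ w (xsection B w))%E ;
  sm_fiber : {ae P, forall w, mu_ w (fiber theta b a w) = 1%E} }.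

(* This entropy is finite under [random_transition_matrix], so [fine] loses
   nothing. *)
Definition subshift_entropy theta (nu : probability (Omega * symb)%type R) : R :=
  fine (metric_entropy nu (skew_product theta) (fun z => z.2 0%N)).

End random_subshift.

(* Main.v *)
Require Import Defs.
From HB Require Import structures.
From mathcomp Require Import all_boot all_order all_algebra.
From mathcomp Require Import all_classical all_reals all_analysis.
From mathcomp Require Import measurable_realfun.
From mathcomp Require Import zify ring lra.

Set Implicit Arguments.
Unset Strict Implicit.
Unset Printing Implicit Defensive.

Import Order.TTheory GRing.Theory Num.Theory.
Import numFieldNormedType.Exports.

Local Open Scope classical_set_scope.
Local Open Scope ring_scope.

(** Fix a typical sequence [y], and let [C] be its [n]-cylinder and [mu C] its
    annealed measure. Under the sample measure of a fibre [w], the events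
    [E k], that the [k]-th iterate of [x] is in [C], are rare, and one wants the
    probability that none of the first [N ~ t / mu C] of them occurs.

    Let [v k] be the probability that no [E j] with [k < j <= N] occurs, and
    [a k] that of [E k]. If the occurrence of [E k.+1] were independent of the
    later ones, then [v k = (1 - a k.+1) * v k.+1], whence
    [v 0 ~ expR (- \sum_k a k)]. The lemma [avoidance_probability] bounds the
    error of this recursion: mixing handles the hits after a gap [G], so what
    matters is that a hit is seldom followed by another one before [G]. Since
    [E k.+1] comes first, the mixing bound is always used in the fibre [w]
    itself, and only the one random constant [C w] enters. It remains to prove
    that, for almost every [w], the sum of the [a k] tends to [t] and that of
    the probabilities of a hit followed by an early second hit tends to 0.

    Both are sums over [k] of the sample measures of the [k]-th preimage of a
    set depending on few symbols. The mixing hypotheses, quenched and annealed,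
    bound their correlations as functions of [w] ([sample_correlation]; taking
    [p]-th powers copes with a constant that is only in Lp), and second moments
    summable in [n] give almost sure convergence ([sum_concentration]). This
    uses that [mu C] is not much smaller than [expR (- h * n)] and reduces the
    second sum to an annealed statement: given [C], the probability of an early
    return to [C] tends to 0.

    The lower bound on [mu C] is the upper half of the Shannon-McMillan-Breiman
    theorem, up to a factor in the exponent, for which the hypothesis on [q]
    leaves room ([cyl_pr_lower_bound]). One compares [mu C] with the product of
    the measures of its blocks of length [k]: the products add up to at most 1
    over all words, so they seldom exceed the measure by much
    ([block_product_exceeds]), and their logarithm is a Birkhoff sum, controlled
    by the maximal ergodic inequality ([birkhoff_sum_bounded]) and a zero-one
    law that follows from mixing ([shift_zero_one]). The block length is chosen
    by the definition of [h] as a limit of block entropies.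

    For the early returns, the measure of the sequences [x] whose word of length
    [n] reappears at time [i] is estimated by grouping the words into about
    [i ^ 2] classes, to which mixing applies with a bearable total error
    ([self_return_le]); periods shorter than [n / 4] are replaced by a multiple.
    This makes early returns improbable along the lengths [8 * 2 ^ j], and a
    maximal inequality for the filtration by cylinders turns this into a
    statement on the relative measure inside the cylinders of almost every [y]
    ([short_return_negligible]). *)

(** * Sets of sequences depending on finitely many symbols *)

Definition finitary (n : nat) (A : set symb) :=
  forall x z : symb, (forall i, (i < n)%N -> x i = z i) -> A x -> A z.

Lemma finitary_cylinder n y : finitary n (cylinder n y).
Proof. by move=> x z xz Cx i ni; rewrite -xz// Cx. Qed.

Lemma finitary_le m n A : (m <= n)%N -> finitary m A -> finitary n A.
Proof.
by move=> mn fA x z xz; apply: fA => i im; apply: xz; exact: leq_trans mn.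
Qed.

Lemma finitaryT n : finitary n setT. Proof. by []. Qed.

Lemma finitaryI n A B : finitary n A -> finitary n B -> finitary n (A `&` B).
Proof. by move=> fA fB x z xz [/(fA _ _ xz) ? /(fB _ _ xz)]. Qed.

Lemma finitaryC n A : finitary n A -> finitary n (~` A).
Proof.
move=> fA x z xz Ax Az; apply: Ax; apply: fA Az => i ni; exact/esym/xz.
Qed.

Lemma finitary_bigcup (I : Type) (D : set I) n (F : I -> set symb) :
  (forall i, D i -> finitary n (F i)) -> finitary n (\bigcup_(i in D) F i).
Proof. by move=> fF x z xz [i Di Fx]; exists i => //; apply: fF Fx. Qed.

Lemma iter_shiftE k (x : symb) i : iter k left_shift x i = x (k + i)%N.
Proof. by elim: k i => // k IH i; rewrite /= /left_shift IH addnS. Qed.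

Lemma finitary_shift k n A :
  finitary n A -> finitary (k + n) (iter k left_shift @^-1` A).
Proof.
move=> fA x z xz /=; apply: fA => i ni; rewrite !iter_shiftE.
by apply: xz; rewrite ltn_add2l.
Qed.

(** Encoding words by natural numbers turns the [n]-cylinders into the level
    sets of a function with values in [nat], so that partitions into cylinders
    and sums over words are indexed by [nat]. *)
Definition code n (x : symb) : nat := pickle (mkseq x n).

Lemma codeE n (x z : symb) :
  code n x = code n z <-> forall i, (i < n)%N -> x i = z i.
Proof.
split => [/(pcan_inj pickleK) e i ni|e].
  by rewrite -(nth_mkseq 0%N x ni) e nth_mkseq.
by congr pickle; apply/eq_in_map => i; rewrite mem_iota => /andP[_]; exact: e.
Qed.

Lemma cylinderE n y : cylinder n y = [set z | code n z = code n y].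
Proof. by apply/seteqP; split=> z /=; rewrite codeE. Qed.

(** A set that only depends on the first [n] symbols is the union of countably
    many [n]-cylinders, indexed here by the codes of their words. *)
Lemma finitary_cyl_sigma n (A : set symb) : finitary n A -> cyl_sigma n A.
Proof.
move=> fA.
pose F k : set symb := if pselect (exists2 x, A x & code n x = k) is left e
  then cylinder n (sval (cid2 e)) else set0.
have -> : A = \bigcup_k F k.
  apply/seteqP; split=> [x Ax|x [k _]].
    exists (code n x) => //; rewrite /F; case: pselect => [e|[]]; last by exists x.
    by rewrite cylinderE /=; case: cid2.
  rewrite /F; case: pselect => // e; case: cid2 => z Az zk /= /= Cx.
  by apply: fA Az => i ni; rewrite Cx.
apply: (@sigma_algebra_bigcup _ setT) => k; rewrite /F.
case: pselect => [e|_]; last exact: sigma_algebra0.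
by apply: (@sub_sigma_algebra _ setT (@n_cylinders n)); exists (sval (cid2 e)).
Qed.

Lemma measurable_cylinder n y : measurable (cylinder n y : set symb).
Proof.
by apply: (@sub_sigma_algebra _ setT cylinders); exists n => //; exists y.
Qed.

Lemma finitary_measurable n (A : set symb) : finitary n A -> measurable A.
Proof.
move=> /finitary_cyl_sigma; apply: (@sub_sigma_algebra2 _ setT) => B By.
by exists n.
Qed.

Lemma measurable_left_shift : measurable_fun setT left_shift.
Proof.
apply: (@measurability _ _ symb symb setT left_shift cylinders) => //.
move=> _ [_ [n _ [y _ <-]]] <-; rewrite setTI.
apply: (@finitary_measurable (1 + n)).
exact: (@finitary_shift 1 n _ (@finitary_cylinder n y)).
Qed.

Lemma measurable_iter_shift k : measurable_fun setT (iter k left_shift).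
Proof.
elim: k => [|k IH]; first exact: measurable_id.
by apply: measurableT_comp IH; exact: measurable_left_shift.
Qed.

Lemma measurable_shift k (A : set symb) :
  measurable A -> measurable (iter k left_shift @^-1` A).
Proof. by move=> mA; rewrite -[X in measurable X]setTI; exact: measurable_iter_shift. Qed.

Lemma measurable_code n (Q : nat -> Prop) :
  measurable ([set x | Q (code n x)] : set symb).
Proof.
apply: (@finitary_measurable n) => x z xz /=.
by rewrite (iffRL (codeE _ _ _) xz).
Qed.

Lemma finitary_measurable_fun d (T : measurableType d) n (F : symb -> T) :
  (forall x z : symb, (forall i, (i < n)%N -> x i = z i) -> F x = F z) ->
  measurable_fun setT F.
Proof.
move=> FE _ Y _; rewrite setTI; apply: (@finitary_measurable n) => x z xz /=.
by rewrite (FE _ _ xz).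
Qed.

(** * Invariant measures and sample measures *)

Section pushforward.
Context d (T : measurableType d) (R : realType).

Lemma ge0_integral_invariant (m : {measure set T -> \bar R}) (S : T -> T)
    (f : T -> \bar R) :
  measurable_fun setT S -> invariant_measure S m ->
  measurable_fun setT f -> (forall x, 0 <= f x)%E ->
  (\int[m]_x f (S x) = \int[m]_x f x)%E.
Proof.
move=> mS inv mf f0.
have := @ge0_integral_pushforward _ _ T T R S mS m setT f measurableT mf
  (fun y _ => f0 y).
rewrite preimage_setT => <-.
by apply: eq_measure_integral => A mA _; exact: inv.
Qed.

Lemma invariant_measure_iter (m : {measure set T -> \bar R}) (S : T -> T) k :
  measurable_fun setT S -> invariant_measure S m ->
  measurable_fun setT (iter k S) /\ invariant_measure (iter k S) m.
Proof.
move=> mS inv; elim: k => [|k [mSk invk]]; first by split => //; exact: measurable_id.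
split=> [|A mA]; first by apply: (measurableT_comp mS mSk).
rewrite -(inv A mA); apply: invk.
by rewrite -[X in measurable X]setTI; exact: mS.
Qed.

End pushforward.

Section disintegration.
Context d (Omega : measurableType d) (R : realType).
Variables (P : probability Omega R) (k : R.-pker Omega ~> symb).

(** Both sides have the same integral over every event [D]: since [theta] is
    invertible, [D] is the preimage of an event [D'], and [D `*` s @^-1` A]
    that of [D' `*` A]. *)
Lemma sample_equivariant (theta theta' : Omega -> Omega) (s : symb -> symb)
    (nu : probability (Omega * symb)%type R) (A : set symb) :
  measurable_fun setT theta -> measurable_fun setT theta' ->
  cancel theta theta' -> invariant_measure theta P -> measurable_fun setT s ->
  invariant_measure (fun z => (theta z.1, s z.2)) nu ->
  (forall B, measurable B -> nu B = (\int[P]_w k w (xsection B w))%E) ->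
  measurable A ->
  {ae P, forall w, k w (s @^-1` A) = k (theta w) A}.
Proof.
move=> mth mth' thK invP ms invnu dis mA.
have mpre B (f : symb -> symb) : measurable_fun setT f -> measurable B ->
    measurable (f @^-1` B).
  by move=> mf mB; rewrite -[X in measurable X]setTI; exact: mf.
have mk B : measurable B -> measurable_fun setT (fun w => k w B).
  by move=> mB; exact: measurable_kernel.
have k1 w B : measurable B -> (k w B <= 1)%E.
  move=> mB; rewrite -(prob_kernel (s := k) w); apply: le_measure;
    by rewrite ?inE.
have rect D B : measurable D -> measurable B ->
    nu (D `*` B) = (\int[P]_(w in D) k w B)%E.
  move=> mD mB; rewrite dis; last exact: measurableX.
  rewrite [RHS]integral_mkcond; apply: eq_integral => w _.
  rewrite /patch; case: ifPn => wD; first by rewrite in_xsectionX.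
  by rewrite notin_xsectionX// measure0.
have msA : measurable (s @^-1` A) by exact: mpre.
have mkth : measurable_fun setT (fun w => k (theta w) A).
  by apply: (measurableT_comp (mk _ mA)).
suff : ae_eq P setT (fun w => k w (s @^-1` A)) (fun w => k (theta w) A).
  by apply: filterS => w; exact.
apply: integral_ae_eq => //.
- apply/integrableP; split; first exact: mk.
  apply: (@le_lt_trans _ _ (\int[P]_x cst 1 x)%E).
    apply: ge0_le_integral => //.
    - by apply: measurableT_comp => //; exact: mk.
    - by move=> w _; rewrite gee0_abs// k1.
  by rewrite integral_cst// mul1e -ge0_fin_numE// fin_num_measure.
- move=> D _ mD; rewrite -rect//.
  have mD' : measurable (theta' @^-1` D).
    by rewrite -[X in measurable X]setTI; exact: mth'.
  have -> : D `*` s @^-1` A =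
      (fun z => (theta z.1, s z.2)) @^-1` ((theta' @^-1` D) `*` A).
    by apply/seteqP; split=> -[w x] /= []; rewrite thK.
  rewrite invnu; last exact: measurableX.
  rewrite [LHS](rect _ _ mD' mA) [LHS]integral_mkcond.
  rewrite -[LHS](ge0_integral_invariant mth invP); last 2 first.
  - by apply: (measurable_restrictT _ mD').1; apply: measurable_funTS; exact: mk.
  - by move=> w; rewrite /patch; case: ifP.
  rewrite [RHS]integral_mkcond; apply: eq_integral => w _.
  rewrite /patch; suff -> : (theta w \in theta' @^-1` D) = (w \in D) by [].
  by apply/idP/idP; rewrite !inE /= thK.
Qed.

End disintegration.

(** * Probabilities as real numbers *)

Section prob.
Context d (T : measurableType d) (R : realType).
Variables (m : {measure set T -> \bar R}) (m1 : m setT = 1%E).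
Implicit Types A B : set T.

Lemma prE A : measurable A -> m A = (fine (m A))%:E.
Proof.
move=> mA; rewrite fineK// ge0_fin_numE//.
by rewrite (@le_lt_trans _ _ 1%E) ?ltry// -m1 le_measure ?inE.
Qed.

Lemma le_pr A B : measurable A -> measurable B -> A `<=` B ->
  fine (m A) <= fine (m B).
Proof. by move=> mA mB AB; rewrite -lee_fin -!prE// le_measure ?inE. Qed.

Lemma pr_ge0 A : 0 <= fine (m A).
Proof. exact: fine_ge0. Qed.

Lemma pr_le1 A : measurable A -> fine (m A) <= 1.
Proof. by move=> mA; rewrite -lee_fin -prE// -m1 le_measure ?inE. Qed.

Lemma pr_split A B : measurable A -> measurable B ->
  fine (m A) = fine (m (A `&` B)) + fine (m (A `\` B)).
Proof.
move=> mA mB; apply: EFin_inj; rewrite EFinD -!prE//.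
- by rewrite addeC -measureDI.
- exact: measurableD.
- exact: measurableI.
Qed.

Lemma prU_le A B : measurable A -> measurable B ->
  fine (m (A `|` B)) <= fine (m A) + fine (m B).
Proof.
move=> mA mB; rewrite -lee_fin EFinD -!prE//; last exact: measurableU.
exact: measureU2.
Qed.

End prob.

Section prob_more.
Context d (T : measurableType d) (R : realType).
Variables (m : {measure set T -> \bar R}) (m1 : m setT = 1%E).

Lemma pr_bigsetU_le (I : Type) (s : seq I) (Q : pred I) (B : I -> set T) :
  (forall i, measurable (B i)) ->
  fine (m (\big[setU/set0]_(i <- s | Q i) B i)) <=
  \sum_(i <- s | Q i) fine (m (B i)).
Proof.
move=> mB; suff [] : measurable (\big[setU/set0]_(i <- s | Q i) B i) /\
  fine (m (\big[setU/set0]_(i <- s | Q i) B i)) <=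
    \sum_(i <- s | Q i) fine (m (B i)) by [].
apply: (big_rec2 (fun X y => measurable X /\ fine (m X) <= y)) => [|i y X Qi [mX Xy]].
  by rewrite measure0.
split; first exact: measurableU.
by rewrite (le_trans (prU_le m1 _ _))// lerD2l.
Qed.

Lemma pr_bigcup_le (F : (set T)^nat) (r : R) :
  (forall n, measurable (F n)) -> nondecreasing_seq F ->
  (forall n, fine (m (F n)) <= r) -> fine (m (\bigcup_n F n)) <= r.
Proof.
move=> mF ndF Fr; have mU : measurable (\bigcup_n F n) by exact: bigcupT_measurable.
rewrite -lee_fin -prE//; have cv := nondecreasing_cvg_mu (mu := m) mF mU ndF.
rewrite -(cvg_lim _ cv)//; apply: lime_le; first by apply/cvg_ex; eexists; exact: cv.
by apply: nearW => n /=; rewrite prE// lee_fin.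
Qed.

Lemma sum_pr_levels (g : T -> nat) L :
  (forall k, measurable [set x | g x = k]) ->
  \sum_(k < L) fine (m [set x | g x = k :> nat]) = fine (m [set x | (g x < L)%N]).
Proof.
move=> mg; have mlt K : measurable [set x | (g x < K)%N].
  have -> : [set x | (g x < K)%N] = \bigcup_(k in [set k | (k < K)%N]) [set x | g x = k].
    by apply/seteqP; split=> [x gK|x [k kK /= ->//]]; exists (g x).
  by apply: bigcup_measurable.
elim: L => [|L IH].
  rewrite big_ord0 [X in m X](_ : _ = set0) ?measure0//.
  by rewrite -subset0 => x.
rewrite big_ord_recr /= IH (pr_split m1 (mlt L.+1) (mlt L)).
by congr (fine (m _) + fine (m _)); apply/seteqP; split=> x /=; lia.
Qed.

End prob_more.

(** * Rare and nearly independent events *)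

Section avoidance.
Context d (T : measurableType d) (R : realType).
Variables (m : {measure set T -> \bar R}) (m1 : m setT = 1%E).

Lemma expRN_approx (a : R) : 0 <= a <= 1 -> `|1 - a - expR (- a)| <= a ^+ 2.
Proof.
move=> /andP[a0 a1]; rewrite distrC ger0_norm; last first.
  by rewrite subr_ge0 expR_ge1Dx.
have ea : expR (- a) <= (1 + a)^-1.
  rewrite expRN lef_pV2 ?posrE ?expR_gt0//; first exact: expR_ge1Dx.
  by rewrite ltr_pwDl.
suff : (1 + a)^-1 <= 1 - a + a ^+ 2 by lra.
rewrite -[leLHS]mul1r ler_pdivrMr; last by rewrite ltr_pwDl.
have -> : (1 - a + a ^+ 2) * (1 + a) = 1 + a ^+ 3 by ring.
by rewrite lerDl exprn_ge0.
Qed.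

(** Running the recursion [v k = (1 - a k) * v k.+1] backwards from [v N = 1]
    gives a product of factors [1 - a k], each within [a k ^+ 2] of
    [expR (- a k)]; since all factors lie in [0, 1] the errors only add up. *)
Lemma recursion_expR (v a e : nat -> R) N :
  v N = 1 -> (forall k, 0 <= a k <= 1) -> (forall k, 0 <= v k <= 1) ->
  (forall k, (k < N)%N -> `|v k - (1 - a k) * v k.+1| <= e k) ->
  `|v 0%N - expR (- \sum_(k < N) a k)| <= \sum_(k < N) (e k + a k ^+ 2).
Proof.
move=> + a01; elim: N v a e a01 => [|N IH] v a e a01 vN v01 ve.
  by rewrite !big_ord0 oppr0 expR0 vN subrr normr0.
have := IH (v \o succn) (a \o succn) (e \o succn) (fun k => a01 k.+1) vN
  (fun k => v01 k.+1) (fun k => ve k.+1).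
rewrite !big_ord_recl /= /bump /= opprD expRD.
have := ve 0%N isT; have := expRN_approx (a01 0%N).
set s := \sum_(_ < _) a _; set r := \sum_(_ < _) (_ + _).
move=> A B H.
have ea1 : expR (- a 0%N) <= 1 by rewrite expR_le1 oppr_le0; case/andP: (a01 0%N).
have ea0 := expR_ge0 (- a 0%N).
have [v10 v11] := andP (v01 1%N).
have -> : v 0%N - expR (- a 0%N) * expR (- s) =
   (v 0%N - (1 - a 0%N) * v 1%N) + (1 - a 0%N - expR (- a 0%N)) * v 1%N
   + expR (- a 0%N) * (v 1%N - expR (- s)) by ring.
apply: le_trans (ler_normD _ _) _.
apply: lerD; last first.
  by rewrite normrM ger0_norm//; apply: le_trans H; rewrite ler_piMl.
apply: le_trans (ler_normD _ _) _; apply: lerD => //.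
by rewrite normrM (ger0_norm v10); apply: le_trans A; rewrite ler_piMr.
Qed.

Section events.
Variables (E : nat -> set T) (N : nat).
Hypothesis mE : forall k, measurable (E k).

Definition avoid k : set T := ~` \bigcup_(j in [set j | (k < j <= N)%N]) E j.

Lemma measurable_avoid k : measurable (avoid k).
Proof. by apply: measurableC; apply: bigcup_measurable. Qed.

Lemma avoid_ge k : (N <= k)%N -> avoid k = setT.
Proof.
by move=> Nk; rewrite -subTset => x _ [j /= kjN _]; lia.
Qed.

Lemma avoidD k i : avoid k `<=` avoid (k + i).
Proof. by move=> x Vx [j /= kj Ex]; apply: Vx; exists j => //=; lia. Qed.

Lemma pr_avoidS k : (k < N)%N ->
  fine (m (avoid k.+1)) =
  fine (m (avoid k)) + fine (m (E k.+1 `&` avoid k.+1)).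
Proof.
move=> kN; have := pr_split m1 (measurable_avoid k.+1) (mE k.+1).
rewrite setIC addrC => ->; congr (fine (m _) + _).
apply/seteqP; split=> x.
  move=> [Vx Ex] [j /= kj Ejx]; have [jk|jk] := eqVneq j k.+1.
    by apply: Ex; rewrite -jk.
  by apply: Vx; exists j => //=; lia.
move=> Vx; split; last by move=> Ex; apply: Vx; exists k.+1 => //=; lia.
by rewrite -addn1; exact: avoidD.
Qed.

Lemma pr_avoidD k i eps : (forall j, fine (m (E j.+1)) <= eps) -> 0 <= eps ->
  fine (m (avoid (k + i))) <= fine (m (avoid k)) + i%:R * eps.
Proof.
move=> Ee e0; elim: i => [|i IH]; first by rewrite addn0 mul0r addr0.
have [Nki|kiN] := leqP N (k + i).
  rewrite avoid_ge; last by lia.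
  rewrite -(avoid_ge Nki) (le_trans IH)// lerD2l ler_wpM2r// ler_nat//.
rewrite addnS pr_avoidS// -natr1 mulrDl mul1r addrA lerD//.
apply: le_trans (Ee (k + i)%N); apply: le_pr => //.
by apply: measurableI => //; exact: measurable_avoid.
Qed.

(** Splitting off the first event [E k.+1] from the later ones gives
    [v k = v k.+1 - fine (m (E k.+1 `&` avoid k.+1))] for
    [v k = fine (m (avoid k))]. In the last term the next [G] events may be
    forgotten at the price of [s k], after which [E k.+1] decouples from what
    remains at the price of [del]; putting them back costs [G * eps]. This is
    the recursion of [recursion_expR]. Running backwards in time keeps the early
    event on the left of the mixing bound. *)
Lemma avoidance_probability (G : nat) (eps del : R) (s : nat -> R) :
  (0 < G)%N -> 0 <= eps -> 0 <= del ->
  (forall k, fine (m (E k.+1)) <= eps) ->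
  (forall k, (k < N)%N -> (k + G < N)%N ->
    `|fine (m (E k.+1 `&` avoid (k + G)))
      - fine (m (E k.+1)) * fine (m (avoid (k + G)))| <= del) ->
  (forall k, (k < N)%N ->
    fine (m (E k.+1 `&` \bigcup_(i in [set i | (0 < i < G)%N]) E (k.+1 + i)))
      <= s k) ->
  `|fine (m (avoid 0)) - expR (- \sum_(k < N) fine (m (E k.+1)))| <=
  \sum_(k < N) s k + N%:R * del
    + (G%:R + 1) * eps * \sum_(k < N) fine (m (E k.+1)).
Proof.
move=> G0 e0 d0 Ee mix short.
set a := fun k => fine (m (E k.+1)).
have a01 k : 0 <= a k <= 1 by rewrite pr_ge0 pr_le1.
have mV := measurable_avoid.
pose v k := fine (m (avoid k)).
have v01 k : 0 <= v k <= 1 by rewrite pr_ge0 pr_le1.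
have mEV k i : measurable (E k `&` avoid i) by exact: measurableI.
have := @recursion_expR v a (fun k => s k + del + a k * (G%:R * eps)) N.
rewrite {1}/v avoid_ge// m1; move=> /(_ erefl a01 v01) H.
apply: le_trans (H _) _ => [k kN|]; last first.
  have -> : N%:R * del = \sum_(k < N) del by rewrite sumr_const card_ord mulr_natl.
  rewrite mulr_sumr -!big_split /=; apply: ler_sum => k _.
  rewrite -!addrA !lerD2l mulrDl mulrDl mul1r.
  rewrite [a k * _]mulrC lerD2l expr2 ler_wpM2r ?Ee//; by case/andP: (a01 k).
have VkE : v k = v k.+1 - fine (m (E k.+1 `&` avoid k.+1)).
  by rewrite /v (pr_avoidS kN) addrK.
rewrite VkE.
have -> x : v k.+1 - x - (1 - a k) * v k.+1 = a k * v k.+1 - x by ring.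
have kG : (k + G = k.+1 + G.-1)%N by lia.
have far : `|fine (m (E k.+1 `&` avoid (k + G))) - a k * v (k + G)%N| <= del.
  have [Nk|/(mix _ kN)//] := leqP N (k + G).
  by rewrite /v avoid_ge// setIT m1 mulr1 subrr normr0.
have v_le : v k.+1 <= v (k + G)%N by rewrite kG; apply: le_pr => //; exact: avoidD.
have le_v : v (k + G)%N <= v k.+1 + G%:R * eps.
  rewrite kG (le_trans (pr_avoidD _ _ Ee e0))// lerD2l ler_wpM2r// ler_nat; lia.
have up : fine (m (E k.+1 `&` avoid k.+1)) <= fine (m (E k.+1 `&` avoid (k + G))).
  by apply: le_pr => //; rewrite kG; apply: setIS; exact: avoidD.
have mS : measurable
    (E k.+1 `&` \bigcup_(i in [set i | (0 < i < G)%N]) E (k.+1 + i)).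
  by apply: measurableI => //; exact: bigcup_measurable.
have lo : fine (m (E k.+1 `&` avoid (k + G))) <=
    fine (m (E k.+1 `&` avoid k.+1)) + s k.
  rewrite (le_trans _ (lerD (lexx _) (short k kN)))//.
  rewrite (le_trans _ (prU_le m1 _ _))//; apply: le_pr => //.
    exact: measurableU.
  move=> x [Ex Vx]; have [[j /= kj Ej]|nE] :=
    pselect ((\bigcup_(j in [set j | (k.+1 < j <= N)%N]) E j) x); last by left.
  right; split=> //; exists (j - k.+1)%N; last by rewrite subnKC//; lia.
  rewrite /=; apply/andP; split; first by lia.
  rewrite ltnNge; apply/negP => Gj; apply: Vx; exists j => //=; lia.
have ak0 : 0 <= a k by case/andP: (a01 k).
have sk0 : 0 <= s k by apply: le_trans (short k kN); exact: pr_ge0.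
have av1 : a k * v k.+1 <= a k * v (k + G)%N by rewrite ler_wpM2l.
have av2 : a k * v (k + G)%N <= a k * v k.+1 + a k * (G%:R * eps).
  by rewrite -mulrDr ler_wpM2l.
have ge0 : 0 <= a k * (G%:R * eps) by rewrite !mulr_ge0.
move: far; rewrite !ler_norml => /andP[f1 f2]; apply/andP; split; lra.
Qed.

End events.
End avoidance.

(** * Second moments and almost sure convergence *)

Lemma sum_nat_window N lo hi :
  (\sum_(l < N) ((lo <= l) && (l < hi)) <= hi - lo)%N.
Proof.
suff : (\sum_(l < N) ((lo <= l) && (l < hi)) <= minn N hi - lo)%N by lia.
elim: N => [|N IH]; first by rewrite big_ord0.
by rewrite big_ord_recr /=; move: IH; set s := bigop _ _ _; lia.
Qed.

Lemma integral_prob_cst d (T : measurableType d) (R : realType)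
  (P : probability T R) (c : R) : (\int[P]_w c%:E = c%:E)%E.
Proof.
rewrite integral_cst// [X in (_ * X)%E](_ : _ = 1%E) ?mule1//.
exact: probability_setT.
Qed.

Section weak_dependence.
Context d (Omega : measurableType d) (R : realType).
Variable P : probability Omega R.

(** Expanding the square, the pairs at distance less than [G] are handled with
    the uniform bound [eps], all others with the correlation bound [beta]. *)
Lemma second_moment_window (a : nat -> Omega -> R) (N G : nat)
    (M eps beta : R) :
  (forall k, measurable_fun setT (a k)) ->
  (forall k w, 0 <= a k w) ->
  (forall k, {ae P, forall w, a k w <= eps}) ->
  (forall k, (\int[P]_w (a k w)%:E = M%:E)%E) ->
  (forall k l, (k + G <= l)%N ->
    (\int[P]_w (a k w * a l w)%:E <= (M ^+ 2 + beta)%:E)%E) ->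
  0 <= beta -> 0 <= eps ->
  (\int[P]_w ((\sum_(k < N) a k w - N%:R * M) ^+ 2)%:E <=
     (2 * N%:R * G%:R * eps * M + N%:R ^+ 2 * beta)%:E)%E.
Proof.
move=> ma a0 ae_eps aM cor beta0 eps0.
have M0 : 0 <= M.
  by rewrite -lee_fin -(aM 0%N); apply: integral_ge0 => w _; rewrite lee_fin.
have maa k l : measurable_fun setT (fun w => (a k w * a l w)%:E).
  by apply/measurable_EFinP; exact: measurable_funM.
pose X w := \sum_(k < N) a k w.
have mX : measurable_fun setT X by apply: measurable_sum.
have X0 w : 0 <= X w by apply: sumr_ge0.
have pair k l : (\int[P]_w (a k w * a l w)%:E <=
    (M ^+ 2 + beta + ((k.+1 - G <= l) && (l < k + G))%N%:R * (eps * M))%:E)%E.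
  wlog kl : k l / (k <= l)%N.
    move=> H; have [/H//|/ltnW lk] := leqP k l.
    under eq_integral do rewrite mulrC.
    apply: le_trans (H _ _ lk) _; rewrite lee_fin lerD2l.
    by rewrite ler_wpM2r ?mulr_ge0// ler_nat; lia.
  have [kGl|lkG] := leqP (k + G) l.
    by rewrite andbF mul0r addr0 cor.
  have -> : (k.+1 - G <= l)%N by lia.
  rewrite mul1r; apply: (@le_trans _ _ (eps * M)%:E); last first.
    by rewrite lee_fin lerDr addr_ge0// sqr_ge0.
  rewrite EFinM -(aM k) -ge0_integralZl//; last 2 first.
  - exact/measurable_EFinP.
  - by move=> w _; rewrite lee_fin.
  apply: ae_ge0_le_integral => //.
  - by move=> w _; rewrite lee_fin mulr_ge0.
  - by move=> w _; rewrite -EFinM lee_fin mulr_ge0.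
  - apply/measurable_EFinP; apply: measurable_funM => //; exact: measurable_cst.
  apply: filterS (ae_eps l) => w H _.
  by rewrite -EFinM lee_fin mulrC ler_wpM2r.
have X2 : (\int[P]_w (X w ^+ 2)%:E <=
    (N%:R ^+ 2 * (M ^+ 2 + beta) + 2 * N%:R * G%:R * eps * M)%:E)%E.
  have -> : (\int[P]_w (X w ^+ 2)%:E =
      \sum_(k < N) \sum_(l < N) \int[P]_w (a k w * a l w)%:E)%E.
    under eq_integral => w _.
      rewrite expr2 /X mulr_suml; under eq_bigr do rewrite mulr_sumr.
      rewrite -sumEFin; under eq_bigr do rewrite -sumEFin; over.
    rewrite /= ge0_integral_sum//; last 2 first.
    - by move=> k; apply: emeasurable_sum.
    - move=> k w _; apply: sume_ge0 => l _; by rewrite lee_fin mulr_ge0.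
    apply: eq_bigr => k _; rewrite ge0_integral_sum//.
    by move=> l w _; rewrite lee_fin mulr_ge0.
  apply: (@le_trans _ _ (\sum_(k < N) (\sum_(l < N) (M ^+ 2 + beta
    + ((k.+1 - G <= l) && (l < k + G))%N%:R * (eps * M))%:E))%E).
    by apply: lee_sum => k _; apply: lee_sum => l _; exact: pair.
  under eq_bigr do rewrite sumEFin.
  rewrite sumEFin lee_fin.
  apply: (@le_trans _ _ (\sum_(k < N)
     (N%:R * (M ^+ 2 + beta) + 2 * G%:R * (eps * M)))).
    apply: ler_sum => k _; rewrite big_split /= sumr_const card_ord mulr_natl.
    rewrite lerD2l -mulr_suml ler_wpM2r ?mulr_ge0//.
    rewrite -natr_sum -natrM ler_nat (leq_trans (sum_nat_window _ _ _))//; lia.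
  by rewrite sumr_const card_ord -[leLHS]mulr_natl; lra.
have XM : (\int[P]_w (X w)%:E = (N%:R * M)%:E)%E.
  under eq_integral do rewrite -sumEFin.
  rewrite ge0_integral_sum//; last 2 first.
  - by move=> k; exact/measurable_EFinP.
  - by move=> k w _; rewrite lee_fin.
  by under eq_bigr do rewrite aM; rewrite sumEFin sumr_const card_ord mulr_natl.
have mdev : measurable_fun setT (fun w => ((X w - N%:R * M) ^+ 2)%:E).
  apply/measurable_EFinP; apply: measurable_funX; apply: measurable_funB => //.
have NM0 : 0 <= N%:R * M by rewrite mulr_ge0.
have key : (\int[P]_w ((X w - N%:R * M) ^+ 2)%:E
    + (2 * (N%:R * M) * (N%:R * M))%:E =
    \int[P]_w (X w ^+ 2)%:E + ((N%:R * M) ^+ 2)%:E)%E.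
  have -> : ((2 * (N%:R * M) * (N%:R * M))%:E =
      \int[P]_w (2 * (N%:R * M) * X w)%:E)%E.
    under eq_integral do rewrite EFinM.
    rewrite ge0_integralZl//; last 3 first.
    - exact/measurable_EFinP.
    - by move=> w _; rewrite lee_fin.
    - by rewrite lee_fin mulr_ge0.
    by rewrite XM -EFinM.
  have -> : (((N%:R * M) ^+ 2)%:E = \int[P]_w ((N%:R * M) ^+ 2)%:E)%E.
    by rewrite integral_prob_cst.
  rewrite -!ge0_integralD//.
  - by apply: eq_integral => w _; rewrite -!EFinD; congr EFin; ring.
  - by move=> w _; rewrite lee_fin sqr_ge0.
  - by apply/measurable_EFinP; exact: measurable_funX.
  - by move=> w _; rewrite lee_fin sqr_ge0.
  - by move=> w _; rewrite lee_fin sqr_ge0.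
  - by move=> w _; rewrite lee_fin !mulr_ge0.
  - by apply/measurable_EFinP; apply: measurable_funM.
have fin : (\int[P]_w (X w ^+ 2)%:E \is a fin_num)%E.
  rewrite ge0_fin_numE; first by rewrite (le_lt_trans X2)// ltry.
  by apply: integral_ge0 => w _; rewrite lee_fin sqr_ge0.
move: X2 key; rewrite -(fineK fin); set x := fine _.
set y := (\int[P]_w _)%E => + key; rewrite lee_fin => X2.
have yfin : y \is a fin_num.
  by move: key; case: y.
move: key; rewrite -(fineK yfin) -!EFinD => -[key].
by rewrite lee_fin; lra.
Qed.

(** The sum of the squares has a finite integral, so it is almost surely finite
    and its terms tend to 0. *)
Lemma ae_cvg0_second_moment (D : nat -> Omega -> R) (u : nat -> R) (B : R) :
  (forall n, measurable_fun setT (D n)) ->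
  (forall n, (\int[P]_w (D n w ^+ 2)%:E <= (u n)%:E)%E) ->
  (forall n, \sum_(k < n) u k <= B) ->
  {ae P, forall w, (fun n => D n w) @ \oo --> 0}.
Proof.
move=> mD Du uB.
pose f w := (\sum_(0 <= n <oo) (D n w ^+ 2)%:E)%E.
have mD2 n : measurable_fun setT (fun w => (D n w ^+ 2)%:E).
  by apply/measurable_EFinP; exact: measurable_funX.
have D0 n w : (0 <= (D n w ^+ 2)%:E)%E by rewrite lee_fin sqr_ge0.
have If : (\int[P]_w f w < +oo)%E.
  rewrite integral_nneseries//; apply: (@le_lt_trans _ _ B%:E); last exact: ltry.
  apply: lime_le; first by apply: is_cvg_nneseries => n _ _; exact: integral_ge0.
  near=> n; rewrite big_mkord (@le_trans _ _ (\sum_(k < n) u k)%:E)//.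
    by rewrite -sumEFin; apply: lee_sum => k _; exact: Du.
  by rewrite lee_fin.
have mf : measurable_fun setT f by exact: ge0_emeasurable_sum.
have f0 w : (0 <= f w)%E by apply: nneseries_ge0.
have : P.-integrable setT f.
  by apply/integrableP; split=> //; under eq_integral do rewrite gee0_abs//.
move/integrable_ae => /(_ measurableT); apply: filterS => w /(_ I) fw.
have : (fun n => D n w ^+ 2) @ \oo --> 0.
  apply: cvg_series_cvg_0; apply: nnseries_is_cvg => [n|].
    by rewrite sqr_ge0.
  by move: fw; rewrite (ge0_fin_numE (f0 w)).
move=> D2.
have : (fun n => Num.sqrt (D n w ^+ 2)) @ \oo --> (Num.sqrt 0 : R).
  by apply: continuous_cvg D2; exact: sqrt_continuous.
have -> : (fun n => Num.sqrt (D n w ^+ 2)) = (fun n => `|D n w|).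
  by apply/funext => n; rewrite sqrtr_sqr.
by rewrite sqrtr0 => /norm_cvg0.
Unshelve. all: by end_near. Qed.

End weak_dependence.

Lemma sum_geometric_le (R : realType) (r : R) n : 0 <= r < 1 ->
  \sum_(k < n) r ^+ k <= (1 - r)^-1.
Proof.
move=> /andP[r0 r1]; have r1' : 0 < 1 - r by rewrite subr_gt0.
rewrite -[leRHS]mul1r ler_pdivlMr// mulrC.
have := subrXX 1 r n; rewrite expr1n.
under eq_bigr do rewrite expr1n mul1r.
by move=> <-; rewrite gerBl exprn_ge0.
Qed.

(** The squares of the indicators have a summable integral, so the indicators
    tend to 0. *)
Lemma borel_cantelli_geometric d (T : measurableType d) (R : realType)
    (P : probability T R) (B : nat -> set T) (K r : R) :
  (forall n, measurable (B n)) -> 0 <= r < 1 ->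
  (forall n, fine (P (B n)) <= K * r ^+ n) ->
  {ae P, forall w, exists N, forall n, (N <= n)%N -> ~ B n w}.
Proof.
move=> mB r01 PB.
have K0 : 0 <= K by have := PB 0%N; rewrite expr0 mulr1; apply: le_trans; exact: pr_ge0.
suff : {ae P, forall w, (fun n => \1_(B n) w : R) @ \oo --> (0 : R)}.
  apply: filterS => w /cvgrPdist_lt /(_ _ ltr01)[N _ hN].
  exists N => n /hN /=; rewrite sub0r normrN indicE => + Bw.
  by rewrite mem_set// normr1 ltxx.
apply: (@ae_cvg0_second_moment _ _ _ P (fun n => \1_(B n))
  (fun n => K * r ^+ n) (K * (1 - r)^-1)).
- by move=> n; exact: measurable_indic.
- move=> n; under eq_integral => w _.
    have -> : \1_(B n) w ^+ 2 = \1_(B n) w :> R.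
      by rewrite indicE expr2; case: (w \in _); rewrite ?mulr1 ?mulr0.
    over.
  rewrite integral_indic// setIT (prE (probability_setT P) (mB n)) lee_fin.
  exact: PB.
- by move=> n; rewrite -mulr_sumr ler_wpM2l// sum_geometric_le.
Qed.

(** * An almost sure upper bound on Birkhoff sums *)

Lemma measurable_superlevel d (T : measurableType d) (R : realType)
  (f : T -> R) (r : R) :
  measurable_fun setT f -> measurable [set x | r < f x].
Proof.
move=> mf; have -> : [set x | r < f x] = setT `&` f @^-1` `]r, +oo[%classic.
  by apply/seteqP; split=> x /=; rewrite in_itv /= andbT => //; case.
by apply: mf => //; exact: measurable_itv.
Qed.

Section ergodic_upper_bound.
Context d (T : measurableType d) (R : realType).
Variables (m : {measure set T -> \bar R}) (m1 : m setT = 1%E).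
Variables (S : T -> T) (mS : measurable_fun setT S) (invS : invariant_measure S m).
Variables (f : T -> R) (mf : measurable_fun setT f) (f0 : forall x, 0 <= f x).

Definition birkhoff_sum n x := \sum_(i < n) f (iter i S x).

Lemma birkhoff_sumS n x : birkhoff_sum n.+1 x = f x + birkhoff_sum n (S x).
Proof.
rewrite /birkhoff_sum big_ord_recl; congr (_ + _).
by apply: eq_bigr => i _; rewrite -iterSr.
Qed.

Lemma measurable_birkhoff_sum n : measurable_fun setT (birkhoff_sum n).
Proof.
apply: measurable_sum => i; apply: measurableT_comp => //.
by have [] := invariant_measure_iter i mS invS.
Qed.

Variables (c0 : R) (c0_ge0 : 0 <= c0).

(** [excess n] is the maximum of [birkhoff_sum j - c0 * j] over [j <= n],
    computed recursively. *)
Fixpoint excess n : T -> R :=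
  if n is n'.+1 then fun x => Num.max 0 (f x - c0 + excess n' (S x)) else cst 0.

Lemma excess_ge0 n x : 0 <= excess n x.
Proof. by case: n => //= n; rewrite le_max lexx. Qed.

Lemma excess_leS n x : excess n x <= excess n.+1 x.
Proof.
elim: n x => [|n IH] x; first exact: (excess_ge0 1).
rewrite [leLHS]/= [leRHS]/= ge_max !le_max lexx /= lerD2l.
by apply/orP; right; exact: IH.
Qed.

Lemma birkhoff_sum_excess n x : birkhoff_sum n x - c0 * n%:R <= excess n x.
Proof.
elim: n x => [|n IH] x; first by rewrite /birkhoff_sum big_ord0 mulr0 subr0.
rewrite birkhoff_sumS [leRHS]/= le_max; apply/orP; right.
by have := IH (S x); rewrite -natr1 mulrDr mulr1; lra.
Qed.

Lemma measurable_excess n : measurable_fun setT (excess n).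
Proof.
elim: n => [|n IH]; first exact: measurable_cst.
apply: measurable_maxr; first exact: measurable_cst.
by apply: measurable_funD; [exact: measurable_funB|exact: measurableT_comp IH mS].
Qed.

Hypothesis fc0 : (\int[m]_x (f x)%:E < c0%:E)%E.

Lemma integral_excess_lty n : (\int[m]_x (excess n x)%:E < +oo)%E.
Proof.
have mE k : measurable_fun setT (fun x => (excess k x)%:E).
  exact/measurable_EFinP/measurable_excess.
have E0 k x : (0 <= (excess k x)%:E)%E by rewrite lee_fin excess_ge0.
elim: n => [|n IH].
  by rewrite /=; under eq_integral do rewrite /cst; rewrite integral0 ltry.
have mfE : measurable_fun setT (fun x => (f x)%:E) by exact/measurable_EFinP.
have mES : measurable_fun setT (fun x => (excess n (S x))%:E).
  exact: (measurableT_comp (mE n) mS).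
apply: (@le_lt_trans _ _ (\int[m]_x ((f x)%:E + (excess n (S x))%:E))%E).
  apply: ge0_le_integral => //.
  - exact: emeasurable_funD.
  - move=> x _; rewrite -EFinD lee_fin /= ge_max addr_ge0 ?excess_ge0//=.
    by rewrite lerD2r gerBl.
rewrite ge0_integralD//; last by move=> x _; rewrite lee_fin.
rewrite (ge0_integral_invariant mS invS (mE n) (E0 n)) lte_add_pinfty//.
by rewrite (lt_trans fc0)// ltry.
Qed.

(** The maximal ergodic inequality: where the excess is positive, [f] is at
    least [c0 + excess n - excess n \o S], and the last two terms have the same
    integral. *)
Lemma maximal_ergodic n :
  (c0%:E * m [set x | 0 < excess n.+1 x]%R <= \int[m]_x (f x)%:E)%E.
Proof.
set D := [set x | _].
have mE k : measurable_fun setT (fun x => (excess k x)%:E).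
  exact/measurable_EFinP/measurable_excess.
have E0 k x : (0 <= (excess k x)%:E)%E by rewrite lee_fin excess_ge0.
have mD : measurable D.
  exact/measurable_superlevel/measurable_excess.
have mfE : measurable_fun setT (fun x => (f x)%:E) by exact/measurable_EFinP.
have mES : measurable_fun setT (fun x => (excess n (S x))%:E).
  exact: (measurableT_comp (mE n) mS).
have fin : (\int[m]_x (excess n x)%:E \is a fin_num)%E.
  by rewrite ge0_fin_numE ?integral_excess_lty// integral_ge0.
rewrite -(leeD2rE _ _ fin).
have m1D : measurable_fun setT (fun x => (c0 * \1_D x)%:E).
  apply/measurable_EFinP; apply: measurable_funM => //.
have -> : (c0%:E * m D = \int[m]_x (c0 * \1_D x)%:E)%E.
  under eq_integral do rewrite EFinM.
  rewrite ge0_integralZl//.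
  - by rewrite integral_indic// setIT.
  - exact/measurable_EFinP.
rewrite -[X in (_ <= _ + X)%E](ge0_integral_invariant mS invS (mE n) (E0 n)).
have p0 x : (0 <= (c0 * \1_D x)%:E)%E by rewrite lee_fin mulr_ge0.
have f0E x : (0 <= (f x)%:E)%E by rewrite lee_fin.
rewrite -!ge0_integralD//.
apply: ge0_le_integral => //.
- by move=> x _; rewrite adde_ge0.
- exact: emeasurable_funD.
- exact: emeasurable_funD.
move=> x _; rewrite -!EFinD lee_fin indicE.
have := excess_leS n x; have [Dx|nDx] := boolP (x \in D).
  move: Dx; rewrite inE /D /= lt_max ltxx /= mulr1 => h.
  by rewrite le_max => /orP[]; have := excess_ge0 n x; lra.
have -> : excess n.+1 x = 0.
  apply/eqP; rewrite eq_le excess_ge0 andbT leNgt; apply/negP => h.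
  by move/negP: nDx; apply; rewrite inE.
move=> h; rewrite mulr0 add0r (le_trans h)// addr_ge0//.
exact: excess_ge0.
Qed.

(** The points where [birkhoff_sum n x - c0 * n] is unbounded form an invariant
    set. If it had measure 1, the excess would eventually be positive almost
    everywhere, and the maximal inequality would give [c0 <= \int f]. *)
Lemma birkhoff_sum_bounded :
  (forall B, measurable B -> S @^-1` B = B -> m B = 0%E \/ m B = 1%E) ->
  {ae m, forall x, exists K : nat, forall n,
    birkhoff_sum n x <= c0 * n%:R + K%:R}.
Proof.
move=> erg.
pose U K n : set T := [set x | c0 * n%:R + K%:R < birkhoff_sum n x].
pose B := \bigcap_K \bigcup_n U K n.
have mU K n : measurable (U K n).
  exact/measurable_superlevel/measurable_birkhoff_sum.
have mB : measurable B.
  by apply: bigcapT_measurable => K; exact: bigcupT_measurable.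
have invB : S @^-1` B = B.
  apply/seteqP; split=> x Bx K _.
    have [n _] := Bx (K + Num.truncn c0).+1 I; rewrite /U /= => h.
    exists n.+1 => //; rewrite /U /= birkhoff_sumS.
    have := truncnS_gt c0; have := f0 x; move: h.
    by rewrite -!natr1 natrD mulrDr; lra.
  have [[|n] _] := Bx (K + Num.truncn (f x)).+1 I; rewrite /U /=.
    by rewrite /birkhoff_sum big_ord0 mulr0 add0r ltNge ler0n.
  rewrite birkhoff_sumS => h; exists n => //; rewrite /U /=.
  have := c0_ge0; have := truncnS_gt (f x); move: h; rewrite -!natr1 natrD mulrDr; lra.
have [mB0|mB1] := erg B mB invB.
  exists B; split => // x nx; apply: contrapT => nBx; apply: nx.
  apply: contrapT => H; apply: nBx => K _; apply: contrapT => nU.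
  apply: H; exists K => n; rewrite leNgt; apply/negP => h.
  by apply: nU; exists n.
have : (c0%:E <= \int[m]_x (f x)%:E)%E.
  pose D n := [set x | 0 < excess n.+1 x].
  have mD n : measurable (D n) by exact/measurable_superlevel/measurable_excess.
  have ndD : nondecreasing_seq D.
    apply/nondecreasing_seqP => n; apply/subsetPset => x.
    by rewrite /D /= => h; rewrite (lt_le_trans h)//; exact: (excess_leS n.+1).
  have mUD : measurable (\bigcup_n D n) by exact: bigcupT_measurable.
  have UD : m (\bigcup_n D n) = 1%E.
    apply/eqP; rewrite eq_le -{1}m1 -{1}mB1.
    rewrite !le_measure ?inE// => x Bx.
    have [[|n] _] := Bx 0%N I; rewrite /U /= addr0.
      by rewrite /birkhoff_sum big_ord0 mulr0 ltxx.
    move=> h; exists n => //.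
    by apply: (lt_le_trans _ (birkhoff_sum_excess n.+1 x)); rewrite subr_gt0.
  have : (fun n => c0%:E * m (D n))%E @ \oo --> (c0%:E * m (\bigcup_n D n))%E.
    by apply: cvgeZl => //; exact: nondecreasing_cvg_mu.
  rewrite UD mule1 => cv; rewrite -(cvg_lim _ cv)//.
  apply: lime_le; first by apply/cvg_ex; exists c0%:E.
  by apply: nearW => n; exact: maximal_ergodic.
by rewrite leNgt fc0.
Qed.

End ergodic_upper_bound.

(** * Mixing implies a zero-one law *)

Section zero_one_law.
Context (R : realType).
Variables (m : {measure set symb -> \bar R}) (m1 : m setT = 1%E).

Definition pr_diff (A B : set symb) := fine (m (A `\` B)) + fine (m (B `\` A)).

Lemma pr_dist_le A B : measurable A -> measurable B ->
  `|fine (m A) - fine (m B)| <= pr_diff A B.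
Proof.
move=> mA mB; rewrite (pr_split m1 mA mB) (pr_split m1 mB mA) setIC.
have := pr_ge0 m (A `\` B); have := pr_ge0 m (B `\` A).
by rewrite /pr_diff ler_norml => ? ?; apply/andP; split; lra.
Qed.

Lemma pr_diffI A A' B B' : measurable A -> measurable A' ->
  measurable B -> measurable B' ->
  pr_diff (A `&` B) (A' `&` B') <= pr_diff A A' + pr_diff B B'.
Proof.
move=> mA mA' mB mB'.
have H (X X' Y Y' : set symb) : measurable X -> measurable X' ->
    measurable Y -> measurable Y' -> fine (m ((X `&` Y) `\` (X' `&` Y')))
    <= fine (m (X `\` X')) + fine (m (Y `\` Y')).
  move=> mX mX' mY mY'.
  rewrite (le_trans _ (prU_le m1 _ _))//; try exact: measurableD.
  apply: le_pr => //.
  - by apply: measurableD; exact: measurableI.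
  - by apply: measurableU; exact: measurableD.
  move=> x [[Xx Yx] n]; have [X'x|] := pselect (X' x); last by left.
  by right; split=> // Y'x; apply: n.
have := H _ _ _ _ mA mA' mB mB'; have := H _ _ _ _ mA' mA mB' mB.
by rewrite /pr_diff; lra.
Qed.

(** The approximable events form a lambda-system containing the pi-system of
    finitary events. *)
Lemma finitary_approx (B : set symb) (eps : R) : measurable B -> 0 < eps ->
  exists n B', finitary n B' /\ pr_diff B B' <= eps.
Proof.
pose H := [set B : set symb | measurable B /\ forall eps, 0 < eps ->
  exists n B', finitary n B' /\ pr_diff B B' <= eps].
pose G := [set B : set symb | exists n, finitary n B].
move=> mB e0; suff [_ /(_ _ e0)] : H B by [].
suff GH : <<s G >> `<=` H.
  apply: GH; apply: sub_sigma_algebra2 mB => _ [n _ [y _ <-]].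
  by exists n; exact: finitary_cylinder.
have fG A n : finitary n A -> measurable A by exact: finitary_measurable.
apply: lambda_system_subset => //.
- move=> A A' [n fA] [n' fA']; exists (maxn n n'); apply: finitaryI.
    exact: finitary_le (leq_maxl _ _) fA.
  exact: finitary_le (leq_maxr _ _) fA'.
- split=> //.
  + split=> // e e1; exists 0%N, setT; split; first exact: finitaryT.
    by rewrite /pr_diff setDv measure0 /= addr0 ltW.
  + move=> A A' A'A [mA hA] [mA' hA']; split; first exact: measurableD.
    move=> e e1; have e2 : 0 < e / 2 by rewrite divr_gt0.
    have [n [B1 [f1 d1]]] := hA _ e2; have [n' [B2 [f2 d2]]] := hA' _ e2.
    exists (maxn n n'), (B1 `\` B2); split.
      rewrite setDE; apply: finitaryI; first exact: finitary_le (leq_maxl _ _) f1.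
      by apply: finitaryC; exact: finitary_le (leq_maxr _ _) f2.
    rewrite !setDE; apply: le_trans (pr_diffI _ _ _ _) _ => //.
    * exact: fG f1.
    * exact: measurableC.
    * by apply: measurableC; exact: fG f2.
    * suff -> : pr_diff (~` A') (~` B2) = pr_diff A' B2 by lra.
      by rewrite /pr_diff !setDE !setCK addrC setIC [in X in _ + X]setIC.
  + move=> F ndF hF; have mF i : measurable (F i) by case: (hF i).
    have mUF : measurable (\bigcup_i F i) by exact: bigcupT_measurable.
    split=> // e e1; have e2 : 0 < e / 2 by rewrite divr_gt0.
    have cv : (fine \o (m \o F)) @ \oo --> fine (m (\bigcup_i F i)).
      apply: fine_cvg; rewrite -prE//; exact: nondecreasing_cvg_mu.
    move/cvgrPdist_le: cv => /(_ _ e2)[j _ /(_ j (leqnn j)) /= hj].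
    have [_ /(_ _ e2) [n [B' [fB' d]]]] := hF j.
    exists n, B'; split=> //; have mB' := fG _ _ fB'.
    have Fj : F j `<=` \bigcup_i F i by exact: bigcup_sup.
    have := pr_split m1 mUF (mF j); rewrite setIidr// => sp.
    have u1 : fine (m (\bigcup_i F i `\` B')) <=
        fine (m (\bigcup_i F i `\` F j)) + fine (m (F j `\` B')).
      rewrite (le_trans _ (prU_le m1 _ _))//; try exact: measurableD.
      apply: le_pr => //; first exact: measurableD.
        by apply: measurableU; exact: measurableD.
      move=> x [Ux nB]; have [Fx|] := pselect (F j x); last by left.
      by right.
    have u2 : fine (m (B' `\` \bigcup_i F i)) <= fine (m (B' `\` F j)).
      apply: le_pr => //; try exact: measurableD.
      by apply: setDS.
    move: hj d; rewrite sp addrAC subrr add0r ger0_norm ?pr_ge0//.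
    by rewrite /pr_diff; lra.
- move=> A [n fA]; split=> [|e e1]; first exact: fG fA.
  by exists n, A; split=> //; rewrite /pr_diff setDv measure0 /= addr0 ltW.
Qed.

Variable del : nat -> R.
Hypothesis del0 : del @ \oo --> 0.
Hypothesis mixing : forall n l g A B, (0 < n)%N -> (0 < g)%N ->
  finitary n A -> finitary l B ->
  `|fine (m (A `&` iter (g + n) left_shift @^-1` B))
    - fine (m A) * fine (m B)| <= del g.
Hypothesis shift_inv : forall k, invariant_measure (iter k left_shift) m.

(** An invariant event is almost independent of itself: it is close to an event
    [B'] depending on finitely many symbols, which is almost independent of its
    own preimage under a large iterate. *)
Lemma shift_zero_one (k : nat) (B : set symb) : (0 < k)%N -> measurable B ->
  iter k left_shift @^-1` B = B -> m B = 0%E \/ m B = 1%E.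
Proof.
move=> k0 mB invB.
have invj j : iter (j * k) left_shift @^-1` B = B.
  elim: j => [|j IH]; first by rewrite mul0n.
  by rewrite mulSn -[RHS]IH -[in RHS]invB; apply/seteqP; split=> x /=;
    rewrite -iterD addnC.
have mS j (A : set symb) : measurable A ->
    measurable (iter j left_shift @^-1` A) by exact: measurable_shift.
have main e : 0 < e -> `|fine (m B) - fine (m B) ^+ 2| <= 5 * e.
  move=> e0; have [n0 [B' [f0 d]]] := finitary_approx mB e0.
  pose n := n0.+1; have fB' : finitary n B' by apply: finitary_le f0; lia.
  have mB' := finitary_measurable fB'.
  move/cvgrPdist_le: (del0) => /(_ _ e0)[g0 _ hg].
  (* [g + n] is a multiple of [k] and [g] is at least [g0]. *)
  pose g := ((g0.+1 + n) * k - n)%N.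
  have gE : (g + n = (g0.+1 + n) * k)%N by rewrite /g subnK//; nia.
  have := mixing (ltn0Sn n0) _ fB' fB' (g := g); rewrite gE.
  move=> /(_ _)/wrap[]; first by rewrite /g; nia.
  move=> mx; have := hg g; rewrite /= sub0r normrN.
  move=> /(_ _)/wrap[]; first by rewrite /g; nia.
  move=> /(le_trans (ler_norm _)) dg.
  set N := ((g0.+1 + n) * k)%N in mx gE.
  have iB : fine (m B) = fine (m (B `&` iter N left_shift @^-1` B)).
    by rewrite invj setIid.
  have sd : pr_diff (iter N left_shift @^-1` B) (iter N left_shift @^-1` B')
      = pr_diff B B'.
    rewrite /pr_diff; congr (fine _ + fine _);
      by apply: (shift_inv N); exact: measurableD.
  have s1 := pr_diffI mB mB' (mS N _ mB) (mS N _ mB').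
  have s2 := pr_dist_le (measurableI _ _ mB (mS N _ mB))
    (measurableI _ _ mB' (mS N _ mB')).
  have s3 := pr_dist_le mB mB'.
  have b0 := pr_ge0 m B; have b1 := pr_le1 m1 mB.
  have b0' := pr_ge0 m B'; have b1' := pr_le1 m1 mB'.
  rewrite -iB in s2; rewrite sd in s1.
  set b := fine (m B) in iB s2 s3 b0 b1 *.
  set b' := fine (m B') in s3 b0' b1' mx *.
  have sq : `|b' * b' - b ^+ 2| <= 2 * e.
    have -> : b' * b' - b ^+ 2 = (b' + b) * (b' - b) by ring.
    rewrite normrM ger0_norm ?addr_ge0//; apply: ler_pM => //.
      by rewrite addr_ge0.
      by lra.
    by rewrite distrC (le_trans s3).
  move: mx sq s2; rewrite !ler_norml => /andP[? ?] /andP[? ?] /andP[? ?].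
  by apply/andP; split; lra.
have : fine (m B) = fine (m B) ^+ 2.
  apply/eqP; rewrite -subr_eq0 -normr_le0; apply/ler_addgt0Pr => e e0.
  by rewrite add0r -[e](mulrVK (unitf_gt0 (ltr0Sn R 4))) mulrC main// divr_gt0.
move=> /eqP; rewrite -subr_eq0 expr2 -{1}[fine _]mulr1 -mulrBr mulf_eq0.
rewrite subr_eq0 => /orP[/eqP b0|/eqP b1].
  by left; rewrite prE// b0.
by right; rewrite prE// -b1.
Qed.

End zero_one_law.

(** * Measures of cylinders from below *)

Section cylinder_lower_bound.
Context (R : realType).
Variable mu : probability symb R.
Hypothesis shift_inv : forall k, invariant_measure (iter k left_shift) mu.

Let mu1 : mu setT = 1%E := probability_setT mu.

Definition cyl_pr n (y : symb) : R := fine (mu (cylinder n y)).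

Lemma cyl_pr_agree n (x z : symb) :
  (forall i, (i < n)%N -> x i = z i) -> cyl_pr n x = cyl_pr n z.
Proof. by move=> xz; rewrite /cyl_pr !cylinderE (iffRL (codeE _ _ _) xz). Qed.

Lemma cyl_pr_ge0 n y : 0 <= cyl_pr n y. Proof. exact: pr_ge0. Qed.

Lemma cyl_pr_le1 n y : cyl_pr n y <= 1.
Proof. by apply: pr_le1 => //; exact: measurable_cylinder. Qed.

Lemma cyl_pr_nincr n k y : (n <= k)%N -> cyl_pr k y <= cyl_pr n y.
Proof.
move=> nk; apply: le_pr => //; try exact: measurable_cylinder.
by move=> z zk i ni; apply: zk; exact: leq_trans nk.
Qed.

Lemma measurable_cyl_pr n : measurable_fun setT (cyl_pr n).
Proof. by apply: (@finitary_measurable_fun _ _ n) => x z; exact: cyl_pr_agree. Qed.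

Lemma cyl_pr_shift k n y : cyl_pr (k + n) y <= cyl_pr n (iter k left_shift y).
Proof.
rewrite /cyl_pr -[X in _ <= fine X](shift_inv k (measurable_cylinder _ _)); apply: le_pr => //.
- exact: measurable_cylinder.
- by apply: measurable_shift; exact: measurable_cylinder.
move=> z zy i ni; rewrite !iter_shiftE; apply: zy; lia.
Qed.

(** There are only countably many null cylinders of each length. *)
Lemma ae_cyl_pr_gt0 : {ae mu, forall y, forall n, 0 < cyl_pr n y}.
Proof.
apply: ae_foralln => n.
have mB : measurable [set y | cyl_pr n y <= 0].
  have -> : [set y | cyl_pr n y <= 0] = ~` [set y | 0 < cyl_pr n y].
    by apply/seteqP; split=> y /=; rewrite leNgt => /negP.
  apply: measurableC; apply: measurable_superlevel; exact: measurable_cyl_pr.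
exists [set y | cyl_pr n y <= 0]; split => //; last first.
  by move=> y /= /negP; rewrite -leNgt.
pose F c : set symb := [set y | cyl_pr n y <= 0] `&` [set y | code n y = c].
have mF c : measurable (F c).
  by apply: measurableI => //; exact: (measurable_code n (fun c' => c' = c)).
have -> : [set y | cyl_pr n y <= 0] = \bigcup_c F c.
  by apply/seteqP; split=> [y y0|y [c _ []]//]; exists (code n y).
rewrite measure_bigcup//; last first.
  by move=> i j _ _ [y [[_ /= <-] [_ /= <-]]].
apply: eseries0 => c _ _; have [[y [y0 yc]]|nF] := pselect (exists y, F c y).
  apply/eqP; rewrite eq_le measure_ge0 andbT.
  apply: (@le_trans _ _ (mu (cylinder n y))).
    rewrite le_measure ?inE//; first exact: measurable_cylinder.
    by move=> z [_ /= zc]; rewrite cylinderE /= zc yc.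
  by rewrite (prE mu1 (measurable_cylinder _ _)) lee_fin.
rewrite (_ : F c = set0) ?measure0// -subset0 => y Fy.
by apply: nF; exists y.
Qed.

Section blocks.
Variables (k : nat) (k0 : (0 < k)%N).

Let S : symb -> symb := iter k left_shift.

Lemma iter_block i : iter i S = iter (i * k) left_shift.
Proof.
by elim: i => // i IH; apply/funext => x; rewrite iterS IH mulSn iterD.
Qed.

Definition block_product M y := \prod_(i < M) cyl_pr k (iter i S y).

Lemma block_product_agree M (x z : symb) :
  (forall i, (i < M * k)%N -> x i = z i) -> block_product M x = block_product M z.
Proof.
move=> xz; apply: eq_bigr => i _; apply: cyl_pr_agree => j jk.
rewrite iter_block !iter_shiftE; apply: xz.
by have := ltn_ord i; nia.
Qed.

(** Under independent blocks, a word of length [M * k] would have probability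
    [block_product M]; these weights add up to at most 1, so the words for which
    the weight exceeds [c] times the actual measure have measure at most [1 / c].
    The sum is taken over words whose blocks have codes less than [L], and then
    [L] goes to infinity. *)
Lemma block_product_exceeds M (c : R) : 0 < c ->
  fine (mu [set y | c * cyl_pr (M * k) y < block_product M y]) <= c^-1.
Proof.
move=> c0; set bad := [set y | _].
have fbad : finitary (M * k) bad.
  move=> x z xz; rewrite /bad /=.
  by rewrite (cyl_pr_agree xz) (block_product_agree xz).
pose blk i y := code k (iter i S y).
have blkE i (x z : symb) : (i < M)%N -> (forall j, (j < M * k)%N -> x j = z j) ->
    blk i x = blk i z.
  move=> iM xz; apply/codeE => j jk; rewrite iter_block !iter_shiftE; apply: xz.
  by nia.
pose pc c : R := fine (mu [set x | code k x = c]).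
have pcE y : cyl_pr k y = pc (code k y) by rewrite /cyl_pr cylinderE.
have bpE y : block_product M y = \prod_(i < M) pc (blk i y).
  by apply: eq_bigr => i _; rewrite pcE.
pose F L := bad `&` [set y | forall i, (i < M)%N -> (blk i y < L)%N].
have fF L : finitary (M * k) (F L).
  apply: finitaryI => // x z xz xL i iM.
  by rewrite -(blkE i x z iM xz) xL.
have mF L := finitary_measurable (fF L).
have mcode c' : measurable [set x | code k x = c'].
  exact: (measurable_code k (fun c => c = c')).
have -> : bad = \bigcup_L F L.
  apply/seteqP; split=> [y By|y [L _ []]//].
  exists (\max_(i < M) blk i y).+1 => //; split => // i iM; rewrite ltnS.
  exact: (@leq_bigmax _ (fun i : 'I_M => blk i y) (Ordinal iM)).
apply: pr_bigcup_le => //.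
  apply/nondecreasing_seqP => L; apply/subsetPset => y [By yL]; split=> //.
  by move=> i /yL h; rewrite ltnW.
move=> L.
pose cell (f : {ffun 'I_M -> 'I_L}) : set symb :=
  bad `&` [set y | forall i : 'I_M, blk i y = f i].
have mcell f : measurable (cell f).
  apply: (@finitary_measurable (M * k)); apply: finitaryI => // x z xz xf i.
  by rewrite -(blkE i x z (ltn_ord i) xz).
apply: (@le_trans _ _ (fine (mu (\big[setU/set0]_f cell f)))).
  apply: le_pr => //; first exact: bigsetU_measurable.
  move=> y [By yL].
  pose f0 := [ffun i : 'I_M => Ordinal (yL i (ltn_ord i))].
  by rewrite (bigD1 f0)//=; left; split=> // i; rewrite ffunE.
apply: le_trans (pr_bigsetU_le mu1 _ _ mcell) _.
apply: (@le_trans _ _ (\sum_(f : {ffun 'I_M -> 'I_L}) c^-1 * \prod_i pc (f i))).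
  apply: ler_sum => f _.
  have pc0 : 0 <= \prod_i pc (f i) by apply: prodr_ge0 => i _; exact: pr_ge0.
  have [[y [By yf]]|nE] := pselect (exists y, cell f y); last first.
    have -> : cell f = set0 by rewrite -subset0 => y fy; apply: nE; exists y.
    by rewrite measure0 mulr_ge0// invr_ge0 ltW.
  rewrite mulrC ler_pdivlMr// mulrC.
  apply: (@le_trans _ _ (c * cyl_pr (M * k) y)).
    rewrite (ler_wpM2l (ltW c0))//; apply: le_pr => //; first exact: measurable_cylinder.
    move=> z [_ zf] j jMk.
    have iM : (j %/ k < M)%N by rewrite ltn_divLR.
    have := zf (Ordinal iM); rewrite -(yf (Ordinal iM)) /blk /=.
    move=> /codeE /(_ (j %% k)%N (ltn_pmod _ k0)).
    by rewrite iter_block !iter_shiftE -divn_eq.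
  have <- : block_product M y = \prod_i pc (f i).
    by rewrite bpE; apply: eq_bigr => i _; rewrite yf.
  exact: ltW.
rewrite -mulr_sumr -(bigA_distr_bigA (fun (_ : 'I_M) (j : 'I_L) => pc j)) /=.
rewrite ler_piMr ?invr_ge0 ?(ltW c0)// prodr_ile1// => i _.
apply/andP; split; first by apply: sumr_ge0 => j _; exact: pr_ge0.
rewrite sum_pr_levels// pr_le1//.
exact: (measurable_code k (fun c' => (c' < L)%N)).
Qed.

Variable del : nat -> R.
Hypothesis del0 : del @ \oo --> 0.
Hypothesis mixing : forall n l g A B, (0 < n)%N -> (0 < g)%N ->
  finitary n A -> finitary l B ->
  `|fine (mu (A `&` iter (g + n) left_shift @^-1` B))
    - fine (mu A) * fine (mu B)| <= del g.

(** The upper half of the Shannon-McMillan-Breiman theorem, with the entropy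
    rate replaced by the block entropy over [k]: almost surely
    [block_product M] is at least [expR (- c0 * M)] up to a constant, and the
    measure of the cylinder is eventually not much smaller. *)
Lemma cyl_pr_lower_bound (c0 hp : R) :
  (\int[mu]_y (- ln (cyl_pr k y))%:E < c0%:E)%E -> c0 < hp * k%:R ->
  {ae mu, forall y, exists N, forall n, (N <= n)%N ->
    expR (- (hp * n%:R)) <= cyl_pr n y}.
Proof.
move=> Hc0 c0hp; pose f y := - ln (cyl_pr k y).
have f0 y : 0 <= f y by rewrite oppr_ge0 ln_le0// cyl_pr_le1.
have mf : measurable_fun setT f.
  by apply: (@finitary_measurable_fun _ _ k) => x z xz; rewrite /f (cyl_pr_agree xz).
have c00 : 0 <= c0.
  rewrite -lee_fin; apply: le_trans (ltW Hc0); apply: integral_ge0 => y _.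
  by rewrite lee_fin; exact: f0.
(* Half of the room between [c0] and [hp * k] is spent on the exceptional sets,
   the other half absorbs all constants. *)
pose eta := (hp * k%:R - c0) / 2.
have eta0 : 0 < eta by rewrite divr_gt0// subr_gt0.
have k0R : 0 < k%:R :> R by rewrite ltr0n.
have hp0 : 0 < hp by rewrite -(pmulr_lgt0 _ k0R); exact: le_lt_trans c0hp.
have mS := measurable_iter_shift k.
have := birkhoff_sum_bounded mu1 mS (shift_inv k) mf f0 c00 Hc0.
move=> /(_ _)/wrap[].
  by move=> B mB; exact: (shift_zero_one mu1 del0 mixing shift_inv k0 mB).
pose bad M := [set y | expR (eta * M%:R) * cyl_pr (M * k) y < block_product M y].
have mbad M : measurable (bad M).
  apply: (@finitary_measurable (M * k)) => x z xz.
  by rewrite /bad /= (cyl_pr_agree xz) (block_product_agree xz).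
have r01 : 0 <= expR (- eta) < 1 by rewrite expR_ge0 expR_lt1 oppr_lt0.
have pbad M : fine (mu (bad M)) <= 1 * expR (- eta) ^+ M.
  rewrite mul1r -expRM_natr mulNr expRN.
  by apply: block_product_exceeds; exact: expR_gt0.
have := borel_cantelli_geometric mbad r01 pbad.
move: ae_cyl_pr_gt0; apply: filterS3 => y ypos [N hN] [K hK].
pose K' := (Num.truncn ((K%:R + hp * k%:R) / eta)).+1.
exists (k * maxn N K')%N => n hn.
(* A word of length [n] is extended to a whole number of blocks. *)
pose M := (n %/ k).+1.
have nM : (n <= M * k)%N by exact/ltnW/ltn_ceil.
have Mn : (M * k <= n + k)%N by rewrite mulSn addnC leq_add2r leq_trunc_div.
have MN : (maxn N K' <= M)%N by rewrite ltnW// ltnS leq_divRL// mulnC.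
have := hN M (leq_trans (leq_maxl _ _) MN) => /negP; rewrite -leNgt => QM.
have ipos i : 0 < cyl_pr k (iter i S y).
  by rewrite iter_block; apply: lt_le_trans (cyl_pr_shift _ _ _); exact: ypos.
have QE : block_product M y = expR (- birkhoff_sum S f M y).
  rewrite /birkhoff_sum -sumrN expR_sum; apply: eq_bigr => i _.
  by rewrite /f opprK lnK ?posrE.
apply: (@le_trans _ _ (expR (- (eta * M%:R) - (c0 * M%:R + K%:R)))).
  rewrite ler_expR.
  have etaM : K%:R + hp * k%:R <= eta * M%:R.
    rewrite [eta * _]mulrC -ler_pdivrMr//; apply: (@le_trans _ _ K'%:R).
      by rewrite ltW// /K' truncnS_gt.
    by rewrite ler_nat; exact: leq_trans (leq_maxr _ _) MN.
  have : hp * (M%:R * k%:R) <= hp * n%:R + hp * k%:R.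
    by rewrite -mulrDr (ler_wpM2l (ltW hp0))// -natrM -natrD ler_nat.
  have : eta * M%:R + eta * M%:R = hp * (M%:R * k%:R) - c0 * M%:R.
    by rewrite /eta; field.
  by move: etaM; lra.
rewrite expRD expRN ler_pdivrMl ?expR_gt0//.
apply: (@le_trans _ _ (block_product M y)).
  by rewrite QE ler_expR lerN2; exact: hK.
apply: le_trans QM _; rewrite ler_wpM2l ?expR_ge0//; exact: cyl_pr_nincr.
Qed.

End blocks.
End cylinder_lower_bound.

(** * Short returns *)

Section mass_classes.
Context d (T : measurableType d) (R : realType).
Variables (m : {measure set T -> \bar R}) (m1 : m setT = 1%E).
Variables (g : T -> nat) (mg : forall Q : nat -> Prop, measurable [set x | Q (g x)]).
Variables (up delta : R) (delta0 : 0 < delta).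
Hypothesis level_up : forall k, fine (m [set x | g x = k]) <= up.

Definition cumul k : R := fine (m [set x | (g x < k)%N]).

(** The level sets of [g], laid side by side in [0, 1], are grouped according
    to the interval [[s * delta, (s + 1) * delta[] in which they start. *)
Definition mass_class k : nat := Num.truncn (cumul k / delta).

Lemma cumulS k : cumul k.+1 = cumul k + fine (m [set x | g x = k]).
Proof.
rewrite /cumul -!(sum_pr_levels m1) ?big_ord_recr//; move=> j; exact: (mg (fun k => k = j)).
Qed.

Lemma mass_class_lt k : (mass_class k < (Num.truncn delta^-1).+1)%N.
Proof.
rewrite ltnS; apply: le_truncn.
rewrite -[leRHS]mul1r; apply: ler_wpM2r; first by rewrite invr_ge0 ltW.
by apply: pr_le1 => //; exact: (mg (fun j => (j < k)%N)).
Qed.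

(** Only the last level set of a class can stick out of the interval of length
    [delta] in which the class starts. *)
Lemma mass_class_le s :
  fine (m [set x | mass_class (g x) = s]) <= delta + up.
Proof.
have up0 : 0 <= up by apply: le_trans (level_up 0); exact: pr_ge0.
pose F L := [set x | mass_class (g x) = s /\ (g x < L)%N].
have mF L : measurable (F L) := mg (fun k => mass_class k = s /\ (k < L)%N).
have -> : [set x | mass_class (g x) = s] = \bigcup_L F L.
  by apply/seteqP; split=> [x xs|x [L _ []]//]; exists (g x).+1.
apply: pr_bigcup_le => //.
  by apply/nondecreasing_seqP => L; apply/subsetPset => x [? /ltnW].
move=> L; suff [] : fine (m (F L)) <= Num.max 0 (cumul L - s%:R * delta) /\
  fine (m (F L)) <= delta + up by [].
elim: L => [|L [IH1 IH2]].
  rewrite [F 0%N](_ : _ = set0) ?measure0; last by rewrite -subset0 => x [].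
  by split; [rewrite /= le_max lexx|rewrite /= addr_ge0// ltW].
have mL : measurable [set x | g x = L] := mg (fun k => k = L).
have [sL|sL] := pselect (mass_class L = s); last first.
  have -> : F L.+1 = F L.
    apply/seteqP; split=> x /= [xs xL]; split=> //; last by lia.
    by rewrite ltn_neqAle -ltnS xL andbT; apply/eqP => gL; apply: sL; rewrite -gL.
  split=> //; apply: le_trans IH1 _.
  rewrite ge_max le_max lexx /= le_max cumulS; apply/orP; right.
  by rewrite lerD2r lerDl pr_ge0.
have cL0 : 0 <= cumul L / delta by rewrite divr_ge0 ?pr_ge0 ?(ltW delta0).
have := truncn_itv cL0; rewrite -/(mass_class L) sL => /andP[].
rewrite ler_pdivlMr// ltr_pdivrMr// -natr1 mulrDl mul1r => lo hi.
have FS : fine (m (F L.+1)) <= fine (m (F L)) + fine (m [set x | g x = L]).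
  rewrite (le_trans _ (prU_le m1 _ _))//; apply: le_pr => //; first exact: measurableU.
  move=> x /= [xs xL]; have [gx|gx] := eqVneq (g x) L; [by right|left].
  by split=> //; lia.
have mx : Num.max 0 (cumul L - s%:R * delta) = cumul L - s%:R * delta.
  by rewrite max_r// subr_ge0.
rewrite mx in IH1; have := level_up L; have := cumulS L.
move=> cS lev; split; last by lra.
by rewrite le_max; apply/orP; right; lra.
Qed.

End mass_classes.

Section returns.
Context (R : realType).
Variable mu : probability symb R.
Variable del : nat -> R.
Hypothesis mixing : forall n l g A B, (0 < n)%N -> (0 < g)%N ->
  finitary n A -> finitary l B ->
  `|fine (mu (A `&` iter (g + n) left_shift @^-1` B))
    - fine (mu A) * fine (mu B)| <= del g.

Let mu1 : mu setT = 1%E := probability_setT mu.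

Definition self_return n i : set symb :=
  [set x | forall j, (j < n)%N -> x (i + j)%N = x j].

Lemma finitary_self_return n i : finitary (i + n) (self_return n i).
Proof. by move=> x z xz xr j jn; rewrite -!xz ?xr//; lia. Qed.

Lemma measurable_self_return n i : measurable (self_return n i).
Proof. exact: finitary_measurable (@finitary_self_return n i). Qed.

(** Mixing cannot be applied to each of the many words of length [n], but it
    can be applied to about [delta^-1] classes of words, each of measure at
    most [delta + up]: a word that returns at time [i] returns to its class. *)
Lemma self_return_le n i (up delta : R) : (0 < n < i)%N -> 0 < delta ->
  (forall y, cyl_pr mu n y <= up) ->
  fine (mu (self_return n i)) <=
    delta + up + (delta^-1 + 1) * del (i - n).
Proof.
move=> /andP[n0 ni] d0 Hup; pose lab x := mass_class mu (code n) delta (code n x).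
pose A s : set symb := [set x | lab x = s].
have fA s : finitary n (A s).
  by move=> x z xz; rewrite /A /lab /= (iffRL (codeE _ _ _) xz).
have mA s : measurable (A s) := finitary_measurable (fA s).
pose r := (Num.truncn delta^-1).+1.
have i0 : (0 < i - n)%N by rewrite subn_gt0.
have iE : (i - n + n = i)%N by rewrite subnK// ltnW.
have level k : fine (mu [set x | code n x = k]) <= up.
  have [[y yk]|nE] := pselect (exists y, code n y = k).
    by rewrite -yk -cylinderE; exact: Hup.
  have -> : [set x | code n x = k] = set0.
    by rewrite -subset0 => x xk; apply: nE; exists x.
  rewrite measure0; apply: le_trans (Hup (fun=> 0%N)); exact: cyl_pr_ge0.
have Aup s : fine (mu (A s)) <= delta + up.
  exact: (mass_class_le mu1 (@measurable_code n) d0 level s).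
have mAi s : measurable (A s `&` iter i left_shift @^-1` A s).
  by apply: measurableI => //; exact: measurable_shift.
apply: (@le_trans _ _ (fine (mu (\big[setU/set0]_(s < r)
    (A s `&` iter i left_shift @^-1` A s))))).
  apply: le_pr => //; [exact: measurable_self_return|exact: bigsetU_measurable|].
  move=> x xr.
  have lr : (lab x < r)%N.
    exact: (mass_class_lt mu1 (@measurable_code n) d0).
  rewrite (bigD1 (Ordinal lr))//=; left; split=> //=.
  rewrite /A /lab /=; congr mass_class; apply/codeE => j jn.
  by rewrite iter_shiftE xr.
apply: le_trans (pr_bigsetU_le mu1 _ _ (fun s : 'I_r => mAi s)) _.
have d_ge0 : 0 <= del (i - n).
  by apply: le_trans (mixing n0 i0 (fA 0%N) (fA 0%N)); exact: normr_ge0.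
apply: (@le_trans _ _ (\sum_(s < r) ((delta + up) * fine (mu (A s)) + del (i - n)))).
  apply: ler_sum => s _; have := mixing n0 i0 (fA s) (fA s).
  rewrite iE ler_norml => /andP[_ h].
  have : fine (mu (A s)) * fine (mu (A s)) <= (delta + up) * fine (mu (A s)).
    by rewrite ler_wpM2r ?pr_ge0.
  by move: h; lra.
rewrite big_split /= -mulr_sumr sumr_const card_ord -[_ *+ r]mulr_natl.
have up0 : 0 <= up by apply: le_trans (Hup (fun=> 0%N)); exact: cyl_pr_ge0.
apply: lerD.
  rewrite ler_piMr ?addr_ge0 ?(ltW d0)//.
  rewrite (sum_pr_levels mu1) ?pr_le1//.
  exact: (measurable_code n (fun k => (mass_class mu (code n) delta k < r)%N)).
rewrite ler_wpM2r// /r -natr1 lerD2r truncn_le// invr_ge0; exact: ltW.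
Qed.

End returns.

Section cylinder_maximal.
Context (R : realType).
Variable mu : probability symb R.

Let mu1 : mu setT = 1%E := probability_setT mu.

Lemma cylinder_average_le n (Z B : set symb) (eps : R) :
  finitary n Z -> measurable B -> 0 < eps ->
  (forall y, Z y -> eps * cyl_pr mu n y <= fine (mu (B `&` cylinder n y))) ->
  eps * fine (mu Z) <= fine (mu (B `&` Z)).
Proof.
move=> fZ mB e0 ZB; rewrite mulrC -ler_pdivlMr//.
pose F L : set symb := Z `&` [set y | (code n y < L)%N].
have mZ := finitary_measurable fZ.
have mcode (Q : nat -> Prop) := @measurable_code n Q.
have mF L : measurable (F L).
  by apply: measurableI => //; exact: (mcode (fun c => (c < L)%N)).
have ZE : Z = \bigcup_L F L.
  by apply/seteqP; split=> [y Zy|y [L _ []]//]; exists (code n y).+1 => //; split=> /=.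
rewrite {1}ZE; apply: pr_bigcup_le => //.
  by apply/nondecreasing_seqP => L; apply/subsetPset => y [? /ltnW].
move=> L; rewrite ler_pdivlMr// mulrC.
apply: (@le_trans _ _ (fine (mu (B `&` F L)))); last first.
  by apply: le_pr => //; try exact: measurableI; apply: setIS => y [].
elim: L => [|L IH].
  rewrite [F 0%N](_ : _ = set0); first by rewrite setI0 measure0 /= mulr0 ?fine_ge0.
  by rewrite -subset0 => y [].
pose E : set symb := Z `&` [set y | code n y = L].
have mlt : measurable [set y | (code n y < L)%N] := mcode (fun c => (c < L)%N).
have FE : F L.+1 `&` [set y | (code n y < L)%N] = F L.
  apply/seteqP; split=> [y [[? _] ?]|y [? /= l]]; first by split.
  by split=> //; split=> //=; exact: leqW.
have EE : F L.+1 `\` [set y | (code n y < L)%N] = E.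
  apply/seteqP; split=> [y [[? /= l] /negP nl]|y [? /= e]].
    by split=> //=; lia.
  by split; [split=> //=; rewrite e|rewrite /= e ltnn].
rewrite (pr_split mu1 (mF L.+1) mlt) FE EE.
rewrite (pr_split mu1 (measurableI _ _ mB (mF L.+1)) mlt).
rewrite -setIA FE -setIDA EE mulrDr; apply: lerD => //.
have [[y [Zy yL]]|nE] := pselect (exists y, E y); last first.
  have -> : E = set0 by rewrite -subset0 => y Ey; apply: nE; exists y.
  by rewrite setI0 measure0 /= mulr0 ?fine_ge0.
have -> : E = cylinder n y; last exact: ZB.
apply/seteqP; split=> z; rewrite cylinderE /= yL; first by case.
by move=> zL; split=> //; apply: fZ Zy; apply/codeE; rewrite yL.
Qed.

(** Doob's maximal inequality for the filtration by cylinders: stopping at the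
    first cylinder in which [B] has relative measure above [eps] gives disjoint
    cylinders. *)
Lemma cylinder_maximal (B : set symb) (eps : R) : measurable B -> 0 < eps ->
  fine (mu [set y | exists n, eps * cyl_pr mu n y < fine (mu (B `&` cylinder n y))])
  <= eps^-1 * fine (mu B).
Proof.
move=> mB e0.
pose D n : set symb :=
  [set y | eps * cyl_pr mu n y < fine (mu (B `&` cylinder n y))].
have fD n : finitary n (D n).
  move=> x z xz; rewrite /D /= (cyl_pr_agree mu xz).
  by rewrite !cylinderE (iffRL (codeE _ _ _) xz).
pose U N : set symb := \bigcup_(n in [set n | (n < N)%N]) D n.
have fU N : finitary N (U N).
  by apply: finitary_bigcup => n /= nN; exact: finitary_le (ltnW nN) (fD n).
have mU N := finitary_measurable (fU N).
have -> : [set y | exists n, D n y] = \bigcup_N U N.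
  apply/seteqP; split=> [y [n Dn]|y [N _ [n _ Dn]]]; last by exists n.
  by exists n.+1 => //; exists n => /=.
apply: pr_bigcup_le => //.
  by apply/nondecreasing_seqP => N; apply/subsetPset => y [n /= /ltnW ? ?]; exists n.
move=> N; rewrite mulrC ler_pdivlMr// mulrC.
apply: (@le_trans _ _ (fine (mu (B `&` U N)))); last first.
  by apply: le_pr => //; exact: measurableI.
elim: N => [|N IH].
  rewrite [U 0%N](_ : _ = set0); first by rewrite setI0 measure0 /= mulr0 ?fine_ge0.
  by rewrite -subset0 => y [].
pose Z := D N `\` U N.
have fZ : finitary N Z by rewrite /Z setDE; apply: finitaryI => //; exact: finitaryC.
have UU : U N.+1 `&` U N = U N.
  apply: setIidr => y [n /= nN Dn]; exists n => //=; lia.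
have UZ : U N.+1 `\` U N = Z.
  apply/seteqP; split=> y [Uy nU]; split=> //; last by exists N => //=.
  have [n /= nN Dn] := Uy; have [->//|nN'] := eqVneq N n.
  by exfalso; apply: nU; exists n => //=; lia.
rewrite (pr_split mu1 (mU N.+1) (mU N)) UU UZ.
rewrite (pr_split mu1 (measurableI _ _ mB (mU N.+1)) (mU N)).
rewrite -setIA UU -setIDA UZ mulrDr; apply: lerD => //.
by apply: cylinder_average_le fZ mB e0 _ => y [Dy _]; exact: ltW.
Qed.

End cylinder_maximal.

Lemma sum_inv_sqr_le (R : realType) a b : (0 < a)%N ->
  \sum_(a.+1 <= i < b) (i%:R ^+ 2)^-1 <= a%:R^-1 :> R.
Proof.
move=> a0; have [ba|ab] := leqP b a.+1.
  by rewrite big_geq// invr_ge0.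
apply: (@le_trans _ _ (\sum_(a.+1 <= i < b) ((- (i.+1.-1)%:R^-1) - (- (i.-1)%:R^-1)))).
  rewrite !big_nat; apply: ler_sum => i /andP[ai ib].
  case: i ai ib => [//|[|i]] ai ib; first by lia.
  rewrite /= opprK.
  have i1 : 0 < i.+1%:R :> R by rewrite ltr0n.
  have i2 : 0 < i.+2%:R :> R by rewrite ltr0n.
  rewrite -subr_ge0.
  have -> : - i.+2%:R^-1 + i.+1%:R^-1 - (i.+2%:R ^+ 2)^-1
      = (i.+1%:R * i.+2%:R ^+ 2)^-1 :> R.
    rewrite -[i.+2%:R]natr1 in i2 *; field.
    by rewrite !gt_eqF.
  by rewrite invr_ge0 mulr_ge0// ?exprn_ge0// ltW.
rewrite (telescope_sumr (fun i => - (i.-1)%:R^-1)); last by lia.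
by rewrite /= opprK gerDr oppr_le0 invr_ge0.
Qed.

Lemma sqr_expRN_le (R : realType) (h : R) (u : nat) : 0 < h ->
  u%:R ^+ 2 * expR (- (h * u%:R)) <= 4 / h ^+ 2.
Proof.
move=> h0; rewrite expRN ler_pdivrMr ?expR_gt0//.
have hu0 : 0 <= h * u%:R / 2 by rewrite divr_ge0 ?mulr_ge0// ltW.
have : (h * u%:R / 2) ^+ 2 <= expR (h * u%:R).
  rewrite [X in expR X](_ : _ = 2%:R * (h * u%:R / 2)); last by field.
  rewrite expRM_natl lerXn2r ?nnegrE ?expR_ge0//.
  by apply: le_trans (expR_ge1Dx _); rewrite lerDr.
have h2 : 0 < h ^+ 2 by rewrite exprn_gt0.
move=> H; rewrite [leRHS]mulrAC ler_pdivlMr//.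
have -> : u%:R ^+ 2 * h ^+ 2 = 4 * (h * u%:R / 2) ^+ 2 by field.
by rewrite ler_wpM2l.
Qed.

Section overlaps.
Variable G : nat -> nat.

Lemma self_return_mul n i l : (0 < l)%N ->
  self_return (n + l.-1 * i) i `<=` self_return n (l * i).
Proof.
case: l => // l _ x; rewrite /self_return /= => H j jn.
elim: l H => [|l IH] H; first by rewrite mul1n H//; lia.
rewrite mulSn -addnA H; last by lia.
by apply: IH => k kn; apply: H; nia.
Qed.

(** The bound [G (16 * u)] on the return time is that of the longest words to
    be compared with their prefix of length [8 * u]. *)
Definition early_return u : set symb :=
  [set x | exists i, (0 < i < G (16 * u))%N /\ self_return (8 * u) i x].

Lemma measurable_early_return u : measurable (early_return u).
Proof.
have -> : early_return u =
    \bigcup_(i in [set i | (0 < i < G (16 * u))%N]) self_return (8 * u) i.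
  by apply/seteqP; split=> [x [i []]|x [i]]; exists i.
by apply: bigcup_measurable => i _; exact: measurable_self_return.
Qed.

(** A return with a small period [i] is also a return with some multiple of [i]
    in [[2 * u, 4 * u[], at which half of the word still agrees. *)
Lemma early_return_sub u : (0 < u)%N -> early_return u `<=`
  \big[setU/set0]_(2 * u <= i < 16 * u) self_return u i `|`
  \big[setU/set0]_(16 * u <= i < G (16 * u)) self_return (8 * u) i.
Proof.
move=> u0 x [i [/andP[i0 iG] xi]].
have mem (a b n k : nat) : (a <= k < b)%N -> self_return n k x ->
    (\big[setU/set0]_(a <= i < b) self_return n i) x.
  move=> kab xk; rewrite (bigD1_seq k) ?iota_uniq ?mem_index_iota//=.
  by left.
have [iu|iu] := leqP (16 * u) i.
  by right; apply: mem xi; rewrite iu.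
left; have weaken n k : (u <= n)%N -> self_return n k x -> self_return u k x.
  by move=> un H j ju; apply: H; lia.
have [iu'|iu'] := leqP (2 * u) i.
  by apply: mem (weaken _ _ _ xi); lia.
pose l := ((2 * u) %/ i).+1.
have ldiv := divn_eq (2 * u) i; have lmod := ltn_pmod (2 * u) i0.
have li1 : (2 * u <= l * i)%N by rewrite /l; nia.
have li2 : (l.-1 * i <= 2 * u)%N by rewrite /l /=; nia.
have li3 : (l * i < 4 * u)%N by rewrite /l mulSn; nia.
apply: (mem _ _ _ (l * i)%N); first by lia.
apply: self_return_mul => // j jn; apply: xi; lia.
Qed.

Definition short_return n y : set symb := cylinder n y `&`
  \bigcup_(i in [set i | (0 < i < G n)%N]) iter i left_shift @^-1` cylinder n y.

Lemma finitary_short_return n y : finitary (n + G n) (short_return n y).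
Proof.
apply: finitaryI.
  by apply: finitary_le (@finitary_cylinder n y); exact: leq_addr.
apply: finitary_bigcup => i /= /andP[_ iG].
apply: (@finitary_le (i + n)); first by lia.
by apply: finitary_shift; exact: finitary_cylinder.
Qed.

End overlaps.

Section short_returns.
Context (R : realType).
Variable mu : probability symb R.
Variable del : nat -> R.
Hypothesis mixing : forall n l g A B, (0 < n)%N -> (0 < g)%N ->
  finitary n A -> finitary l B ->
  `|fine (mu (A `&` iter (g + n) left_shift @^-1` B))
    - fine (mu A) * fine (mu B)| <= del g.
Variables (h0 c D : R) (g0 : nat).
Hypotheses (h0_gt0 : 0 < h0) (c_gt0 : 0 < c) (D_ge0 : 0 <= D).
Hypothesis cyl_up : forall n y, (0 < n)%N ->
  cyl_pr mu n y <= c * expR (- (h0 * n%:R)).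
Hypothesis del_le : forall g, (g0 <= g)%N -> (0 < g)%N ->
  del g <= D / g%:R ^+ 4.

Let mu1 : mu setT = 1%E := probability_setT mu.

(** Classes of measure about [i ^- 2] balance the two error terms of
    [self_return_le] when the correlations decay like [i ^- 4]. *)
Lemma self_return_decay n i : (0 < n)%N -> (2 * n <= i)%N -> (g0 <= i - n)%N ->
  fine (mu (self_return n i)) <=
    (1 + 32 * D) * (i%:R ^+ 2)^-1 + c * expR (- (h0 * n%:R)).
Proof.
move=> n0 ni gi; have i0 : 0 < i%:R :> R by rewrite ltr0n; lia.
have d0 : 0 < (i%:R ^+ 2)^-1 :> R by rewrite invr_gt0 exprn_gt0.
have ni' : (0 < n < i)%N by lia.
apply: le_trans (self_return_le mixing ni' d0 (fun y => cyl_up y n0)) _.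
rewrite invrK.
suff : (i%:R ^+ 2 + 1) * del (i - n) <= 32 * D * (i%:R ^+ 2)^-1 by lra.
have in0 : (0 < i - n)%N by lia.
have hi : 0 < (i - n)%:R :> R by rewrite ltr0n.
have i1 : 1 <= i%:R ^+ 2 :> R by rewrite exprn_ege1// ler1n; lia.
apply: (@le_trans _ _ (2 * i%:R ^+ 2 * (16 * D / i%:R ^+ 4))); last first.
  by rewrite le_eqVlt; apply/orP; left; apply/eqP; field; rewrite gt_eqF.
apply: ler_pM.
- by rewrite addr_ge0// ?ltr01// ltW// (lt_le_trans ltr01).
- apply: le_trans (mixing n0 in0 (@finitaryT n) (@finitaryT n)); exact: normr_ge0.
- lra.
apply: le_trans (del_le gi in0) _.
rewrite ler_pdivrMr ?exprn_gt0// mulrAC ler_pdivlMr ?exprn_gt0//.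
rewrite mulrC [leRHS]mulrAC ler_wpM2r//.
have -> : 16 * (i - n)%:R ^+ 4 = (2 * (i - n)%:R) ^+ 4 :> R by ring.
rewrite lerXn2r ?nnegrE ?ler0n// -natrM ler_nat; lia.
Qed.

Variable G : nat -> nat.
Hypothesis G_le : forall n, (G n)%:R <= (n%:R + 2) * expR (3 / 8 * h0 * n%:R).

(** Words of length [u] control the return times in [[2 * u, 16 * u[]: there
    are few of them. For later return times, whose number is of order
    [expR (6 * h0 * u)], all [8 * u] symbols are needed. *)
Lemma early_return_le : exists2 K : R, 0 <= K &
  forall u, (0 < u)%N -> fine (mu (early_return G u)) <= K / u%:R.
Proof.
pose K := 2 * (1 + 32 * D) + 32 * c * (4 / h0 ^+ 2).
have K0 : 0 <= K.
  have c1 : 0 <= 32 * c by rewrite mulr_ge0 ?ltW.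
  have D1 : 0 <= 1 + 32 * D by move: D_ge0; lra.
  have h1 : 0 <= 4 / h0 ^+ 2 by rewrite divr_ge0 ?sqr_ge0.
  by apply: addr_ge0; apply: mulr_ge0.
exists (K + g0%:R) => [|u u0]; first by rewrite addr_ge0.
have uR : 0 < u%:R :> R by rewrite ltr0n.
have [gu|ug] := leqP g0 u; last first.
  apply: (@le_trans _ _ 1).
    by apply: pr_le1 => //; exact: measurable_early_return.
  by rewrite ler_pdivlMr// mul1r (@le_trans _ _ g0%:R) ?ler_nat ?lerDr// ltnW.
have mS n i : measurable (self_return n i) := @measurable_self_return n i.
have mB n a b : measurable (\big[setU/set0]_(a <= i < b) self_return n i).
  exact: bigsetU_measurable.
apply: (@le_trans _ _ (K / u%:R)); last first.
  by rewrite ler_wpM2r ?invr_ge0 ?(ltW uR)// lerDl.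
apply: le_trans (le_pr mu1 (@measurable_early_return G u)
  (measurableU _ _ (mB _ _ _) (mB _ _ _)) (early_return_sub (G := G) u0)) _.
apply: le_trans (prU_le mu1 (mB _ _ _) (mB _ _ _)) _.
have part a b n e : (2 * u <= a)%N -> (2 * n <= a)%N -> (u <= n)%N ->
    c * expR (- (h0 * n%:R)) <= e ->
    fine (mu (\big[setU/set0]_(a <= i < b) self_return n i)) <=
    (1 + 32 * D) / u%:R + (b - a)%:R * e.
  move=> ua na un ee; apply: le_trans (pr_bigsetU_le mu1 _ _ (mS n)) _.
  apply: (@le_trans _ _ (\sum_(a <= i < b) ((1 + 32 * D) * (i%:R ^+ 2)^-1 + e))).
    rewrite !big_nat; apply: ler_sum => i /andP[ai _].
    by apply: le_trans (self_return_decay _ _ _) _; rewrite ?lerD2l//; lia.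
  rewrite big_split /= -mulr_sumr sumr_const_nat -[e *+ _]mulr_natl lerD2r.
  rewrite ler_wpM2l ?addr_ge0 ?mulr_ge0//.
  have [a' aE] : exists a', a = a'.+1 by exists a.-1; lia.
  rewrite aE; apply: le_trans (sum_inv_sqr_le _ _ _) _; first by lia.
  by rewrite lef_pV2 ?posrE ?ltr0n ?ler_nat; lia.
pose E := expR (- (h0 * u%:R)).
have E0 : 0 < E := expR_gt0 _.
have p1 := part (2 * u)%N (16 * u)%N u (c * E) (leqnn _) (leqnn _) (leqnn _) (lexx _).
have u2_16 : (2 * u <= 16 * u)%N by rewrite leq_mul2r orbT.
have u2_8 : (2 * (8 * u) <= 16 * u)%N by rewrite mulnA.
have u_8 : (u <= 8 * u)%N by rewrite leq_pmull.
have p2 := part (16 * u)%N (G (16 * u)) (8 * u)%N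
  (c * expR (- (h0 * (8 * u)%:R))) u2_16 u2_8 u_8 (lexx _).
apply: le_trans (lerD p1 p2) _.
have b1 : (16 * u - 2 * u)%:R * (c * E) <= 14 * c * (u%:R * E).
  have -> : (16 * u - 2 * u)%:R = 14 * u%:R :> R.
    by rewrite -mulnBl natrM.
  by rewrite le_eqVlt; apply/orP; left; apply/eqP; ring.
have b2 : (G (16 * u) - 16 * u)%:R * (c * expR (- (h0 * (8 * u)%:R)))
    <= 18 * c * (u%:R * E).
  apply: (@le_trans _ _ (((16 * u)%:R + 2) * expR (3 / 8 * h0 * (16 * u)%:R)
     * (c * expR (- (h0 * (8 * u)%:R))))).
    rewrite ler_wpM2r ?mulr_ge0 ?expR_ge0 ?(ltW c_gt0)//.
    by apply: le_trans (G_le _); rewrite ler_nat leq_subr.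
  have EE : expR (3 / 8 * h0 * (16 * u)%:R) * expR (- (h0 * (8 * u)%:R)) <= E.
    rewrite -expRD ler_expR !natrM.
    have : 0 <= h0 * u%:R by rewrite mulr_ge0// ltW.
    by move=> H; lra.
  have u1 : 1 <= u%:R :> R by rewrite ler1n.
  have -> : ((16 * u)%:R + 2) * expR (3 / 8 * h0 * (16 * u)%:R)
     * (c * expR (- (h0 * (8 * u)%:R))) = ((16 * u)%:R + 2) * c *
     (expR (3 / 8 * h0 * (16 * u)%:R) * expR (- (h0 * (8 * u)%:R))) by ring.
  have -> : 18 * c * (u%:R * E) = 18 * u%:R * c * E by ring.
  apply: ler_pM => //.
  - by rewrite mulr_ge0 ?(ltW c_gt0)// addr_ge0.
  - by rewrite ler_wpM2r ?(ltW c_gt0)// natrM; lra.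
have b3 : u%:R * E <= 4 / h0 ^+ 2 / u%:R.
  rewrite ler_pdivlMr//; have := sqr_expRN_le u h0_gt0.
  by rewrite -/E expr2; lra.
have b4 : 32 * c * (u%:R * E) <= 32 * c * (4 / h0 ^+ 2 / u%:R).
  by rewrite ler_wpM2l// mulr_ge0// ltW.
have -> : K / u%:R = 2 * ((1 + 32 * D) / u%:R) + 32 * c * (4 / h0 ^+ 2 / u%:R).
  by rewrite /K mulrDl !mulrA.
move: b1 b2 b4; lra.
Qed.

Hypothesis G_homo : {homo G : n k / (n <= k)%N}.

(** A word of length [n] is compared with its prefix of length [8 * u], [u] the
    power of 2 with [8 * u <= n < 16 * u]; along powers of 2 the probabilities
    of [early_return_le] are summable, and the maximal inequality turns this
    into a statement on almost every sequence of nested cylinders. *)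
Lemma short_return_negligible : {ae mu, forall y, forall eps, 0 < eps ->
  exists N, forall n, (N <= n)%N ->
    fine (mu (short_return G n y)) <= eps * cyl_pr mu n y}.
Proof.
have [K K0 HK] := early_return_le.
pose B J j := early_return G (2 ^ (J + j)).
have mB J j : measurable (B J j) := @measurable_early_return G _.
pose T J : set symb := \bigcup_j B J j.
have mT J : measurable (T J) by exact: bigcupT_measurable.
have half : 0 <= (2^-1 : R) < 1 by apply/andP; split; lra.
have prT J : fine (mu (T J)) <= 2 * K * 2^-1 ^+ J.
  pose U N : set symb := \big[setU/set0]_(j < N) B J j.
  have -> : T J = \bigcup_N U N.
    apply/seteqP; split=> [x [j _ Bx]|x [N _]]; rewrite /U.
      exists j.+1 => //; rewrite -(bigcup_mkord j.+1 (B J)).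
      by exists j => /=.
    by rewrite -(bigcup_mkord N (B J)) => -[j _ Bx]; exists j.
  apply: pr_bigcup_le => //.
  - by move=> N; exact: bigsetU_measurable.
  - by apply/nondecreasing_seqP => N; apply/subsetPset; rewrite /U big_ord_recr; left.
  move=> N; apply: le_trans (pr_bigsetU_le mu1 _ _ (fun j : 'I_N => mB J j)) _.
  apply: (@le_trans _ _ (\sum_(j < N) K * 2^-1 ^+ J * 2^-1 ^+ j)).
    apply: ler_sum => j _; rewrite /B; apply: le_trans (HK _ _) _.
      by rewrite expn_gt0.
    by rewrite natrX -exprVn exprD mulrA.
  rewrite -mulr_sumr.
  have -> : 2 * K * 2^-1 ^+ J = K * 2^-1 ^+ J * 2 :> R by ring.
  rewrite ler_wpM2l ?mulr_ge0 ?exprn_ge0 ?invr_ge0//.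
  apply: le_trans (sum_geometric_le N half) _.
  by rewrite le_eqVlt; apply/orP; left; apply/eqP; field.
have : {ae mu, forall y, forall e : nat, exists J0, forall J, (J0 <= J)%N ->
    ~ exists n, e.+1%:R^-1 * cyl_pr mu n y < fine (mu (T J `&` cylinder n y))}.
  apply: ae_foralln => e.
  pose M J : set symb := [set y | exists n,
    e.+1%:R^-1 * cyl_pr mu n y < fine (mu (T J `&` cylinder n y))].
  have mM J : measurable (M J).
    have -> : M J = \bigcup_n [set y |
        e.+1%:R^-1 * cyl_pr mu n y < fine (mu (T J `&` cylinder n y))].
      by apply/seteqP; split=> [y [n]|y [n _]]; exists n.
    apply: bigcupT_measurable => n; apply: (@finitary_measurable n) => x z xz /=.
    by rewrite (cyl_pr_agree mu xz) !cylinderE (iffRL (codeE _ _ _) xz).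
  apply: (borel_cantelli_geometric (K := e.+1%:R * (2 * K)) mM half) => J.
  apply: le_trans (cylinder_maximal mu (mT J) _) _ => //.
  by rewrite invrK -!mulrA ler_wpM2l// !mulrA.
apply: filterS => y Hy eps e0.
have [J /(_ J (leqnn J)) nM] := Hy (Num.truncn eps^-1).
exists (8 * 2 ^ J)%N => n hn.
pose k := trunc_log 2 (n %/ 8).
have n8 : (0 < n %/ 8)%N.
  by rewrite divn_gt0// (leq_trans _ hn)// leq_pmulr// expn_gt0.
have /andP[k1 k2] := trunc_log_bounds (isT : (1 < 2)%N) n8.
rewrite -/k in k1 k2.
have Jk : (J <= k)%N.
  by apply: trunc_log_max => //; rewrite leq_divRL// mulnC.
have u1 : (8 * 2 ^ k <= n)%N by rewrite mulnC -leq_divRL.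
have u2 : (n <= 16 * 2 ^ k)%N.
  by rewrite ltnW//; move: k2; rewrite ltn_divLR// expnS; lia.
apply: (@le_trans _ _ (fine (mu (T J `&` cylinder n y)))).
  apply: le_pr => //.
  - exact: finitary_measurable (@finitary_short_return G n y).
  - by apply: measurableI => //; exact: measurable_cylinder.
  move=> x [Cx [i /= /andP[i1 i2] Cix]]; split=> //.
  exists (k - J)%N => //; rewrite /B subnKC//; exists i; split.
    by rewrite i1 (leq_trans i2)// G_homo.
  move=> j ju; have jn : (j < n)%N by exact: leq_trans ju u1.
  by rewrite -iter_shiftE Cix// Cx.
apply: (@le_trans _ _ ((Num.truncn eps^-1).+1%:R^-1 * cyl_pr mu n y)).
  by rewrite leNgt; apply/negP => h; apply: nM; exists n.
rewrite ler_wpM2r ?cyl_pr_ge0// -[leRHS]invrK lef_pV2 ?posrE ?ltr0n ?invr_gt0//.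
exact/ltW/truncnS_gt.
Qed.

End short_returns.

(** * Entropy of blocks *)

Section entropy.
Context d (Omega : measurableType d) (R : realType).
Variables (theta : Omega -> Omega) (nu : probability (Omega * symb)%type R).
Variable mu : probability symb R.
Hypothesis nu_mu : forall A : set symb, measurable A -> nu (setT `*` A) = mu A.

Let mu1 : mu setT = 1%E := probability_setT mu.

(** The function [- ln (cyl_pr mu k y)] is constant on the [k]-cylinders, and
    these are the sections of the sets of given itinerary. *)
Lemma integral_ln_cyl_pr k :
  (\int[mu]_y (- ln (cyl_pr mu k y))%:E =
   block_entropy nu (skew_product theta) (fun z => z.2 0%N) k)%E.
Proof.
pose pc c : R := fine (mu [set x | code k x = c]).
pose F c : set symb := [set x | code k x = c].
have mF c : measurable (F c) := measurable_code k (fun c' => c' = c).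
have UF : \bigcup_c F c = setT.
  by rewrite -subTset => x _; exists (code k x).
have pcE y : cyl_pr mu k y = pc (code k y) by rewrite /cyl_pr cylinderE.
have pc0 c : 0 <= pc c by exact: pr_ge0.
have pc1 c : pc c <= 1 by exact: (pr_le1 mu1 (mF c)).
have t0 c : (0 <= (- (pc c * ln (pc c)))%:E)%E.
  by rewrite lee_fin oppr_ge0 mulr_ge0_le0// ln_le0.
rewrite -{1}UF ge0_integral_bigcup//; last 3 first.
- apply: measurable_funTS; apply/measurable_EFinP.
  by apply: (@finitary_measurable_fun _ _ k) => x z xz; rewrite (cyl_pr_agree mu xz).
- by move=> y _; rewrite lee_fin oppr_ge0 ln_le0// cyl_pr_le1.
- by move=> i j _ _ [y [/= <- <-]].
have -> : (\sum_(0 <= c <oo) \int[mu]_(y in F c) (- ln (cyl_pr mu k y))%:E =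
    \sum_(0 <= c <oo) (- (pc c * ln (pc c)))%:E)%E.
  apply: eq_eseriesr => c _.
  rewrite (@eq_integral _ _ _ _ _ (fun=> (- ln (pc c))%:E)); last first.
    by move=> y; rewrite inE => /= yc; rewrite pcE yc.
  rewrite integral_cst// (prE mu1 (mF c)) -EFinM; congr EFin.
  by rewrite -/(pc c); ring.
rewrite nneseries_esum//.
pose e (w : k.-tuple nat) : nat := pickle (tval w).
have e_inj : set_bij [set: k.-tuple nat] (range e) e.
  split; [by move=> w _; exists w| |by []].
  by move=> w w' _ _ /(pcan_inj pickleK) ww'; exact: val_inj.
have -> : (\esum_(c in [set x | xpredT x]) (- (pc c * ln (pc c)))%:E =
    \esum_(c in range e) (- (pc c * ln (pc c)))%:E)%E.
  rewrite [RHS]esum_mkcond (_ : [set x | xpredT x] = setT); last first.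
    by apply/seteqP; split.
  apply: eq_esum => c _; case: ifPn => // ce.
  have -> : pc c = 0.
    rewrite /pc; have -> : [set x | code k x = c] = set0; last by rewrite measure0.
    rewrite -subset0 => x xc; move/negP: ce; apply; rewrite inE.
    by exists (Tuple (introT eqP (size_mkseq x k))).
  by rewrite mul0r oppr0.
rewrite (@reindex_esum _ _ _ _ _ _ _ e_inj) /block_entropy; apply: eq_esum => w _.
suff -> : fine (nu (itinerary (skew_product theta) (fun z => z.2 0%N) w))
    = pc (e w) by [].
have iterE z i : (iter i (skew_product theta) z).2 = iter i left_shift z.2.
  by elim: i => //= i ->.
have -> : itinerary (skew_product theta) (fun z => z.2 0%N) w =
    setT `*` [set x : symb | code k x = e w].
  apply/seteqP; split=> [z zw|z [_ zw] i] /=.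
    split=> //; rewrite /e /code; congr pickle.
    apply: (@eq_from_nth _ 0%N) => [|i]; rewrite size_mkseq ?size_tuple// => ik.
    rewrite nth_mkseq//; have := zw (Ordinal ik).
    by rewrite iterE iter_shiftE addn0 /= (tnth_nth 0%N).
  rewrite iterE iter_shiftE addn0 (tnth_nth 0%N) /=.
  by rewrite -(nth_mkseq 0%N z.2 (ltn_ord i)) (pcan_inj pickleK zw).
by rewrite nu_mu//; exact: mF.
Qed.

End entropy.

(** A limit whose value, cut down to a real number, is nonzero exists and is
    finite: otherwise it would be infinite or a default value. *)
Lemma fine_limn_neq0_lt (R : realType) (u : (\bar R)^nat) (l : R) :
  fine (limn u) != 0 -> fine (limn u) < l ->
  exists N, forall n, (N <= n)%N -> (u n < l%:E)%E.
Proof.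
move=> l0 ul; have cu : cvgn u.
  by apply: contrapT => /dvgP ul0; move: l0; rewrite ul0 eqxx.
have finu : limn u \is a fin_num.
  by move: l0; rewrite fin_numE; case: (limn u) => //=; rewrite eqxx.
have lu : (limn u < l%:E)%E by rewrite -(fineK finu) lte_fin.
have : nbhs (limn u) [set x | (x < l%:E)%E].
  by apply: open_nbhs_nbhs; split=> //; exact: open_ereal_lt_ereal.
by move=> /cu[N _ hN]; exists N => n /hN.
Qed.

(** * The law of hitting times in a fibre *)

Lemma expR_ge1 (R : realType) (x : R) : 0 <= x -> 1 <= expR x.
Proof. by move=> x0; rewrite -(expR0 R) ler_expR. Qed.

Lemma mul_expRN_le (R : realType) (x : R) (n : nat) : 0 < x ->
  n%:R * expR (- (x * n%:R)) <= x^-1.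
Proof.
move=> x0; rewrite expRN ler_pdivrMr ?expR_gt0// mulrC ler_pdivlMr//.
by rewrite mulrC (le_trans _ (expR_ge1Dx _))// lerDr.
Qed.

Lemma cvg_expRN0 (R : realType) (x : R) : 0 < x ->
  (fun n : nat => expR (- (x * n%:R))) @ \oo --> (0 : R).
Proof.
move=> x0; have -> : (fun n : nat => expR (- (x * n%:R))) = (fun n => expR (- x) ^+ n).
  by apply/funext => n; rewrite -expRM_natr mulNr.
by apply: cvg_expr; rewrite ger0_norm ?expR_ge0// expR_lt1 oppr_lt0.
Qed.

Lemma cvg_eq (R : realType) (u v : nat -> R) (l l' : R) :
  u @ \oo --> l -> (forall n, u n = v n) -> l = l' -> v @ \oo --> l'.
Proof. by move=> + /funext <- <-. Qed.

Lemma cvg0_squeeze (R : realType) (u b : nat -> R) N :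
  (forall n, (N <= n)%N -> 0 <= u n <= b n) ->
  b @ \oo --> (0 : R) -> u @ \oo --> (0 : R).
Proof.
move=> ub b0; apply: (@squeeze_cvgr _ _ _ _ (fun=> 0) b); last exact: b0.
  by exists N.
exact: cvg_cst.
Qed.

Lemma hitting_time_gtE (R : realType) (A : set symb) (tau : R) : 0 <= tau ->
  [set x | (tau%:E < hitting_time R x A)%E] =
  avoid (fun j => iter j left_shift @^-1` A) (Num.truncn tau) 0.
Proof.
move=> tau0; have /andP[lo hi] := truncn_itv tau0.
apply/seteqP; split=> x /=.
  move=> tx [j /= /andP[j0 jtau] Aj].
  have : (hitting_time R x A <= j%:R%:E)%E by apply: ereal_inf_lbound; exists j.
  move=> /(lt_le_trans tx); rewrite lte_fin ltNge; move/negP; apply.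
  by apply: le_trans lo; rewrite ler_nat.
move=> nx; apply: (@lt_le_trans _ _ (Num.truncn tau).+1%:R%:E).
  by rewrite lte_fin.
apply: le_ereal_inf_tmp => _ [k [k0 Ak] <-]; rewrite lee_fin ler_nat ltnNge.
by apply/negP => ktau; apply: nx; exists k => //=; rewrite k0.
Qed.

Lemma avoid_preimage (A : set symb) N k :
  avoid (fun j => iter j left_shift @^-1` A) N k = iter k.+1 left_shift @^-1`
    (~` \bigcup_(i in [set i | (i < N - k)%N]) iter i left_shift @^-1` A).
Proof.
apply/seteqP; split=> x nx [j jb Ej]; apply: nx.
  exists (j + k.+1)%N; first by move: jb => /=; lia.
  by change (A (iter (j + k.+1) left_shift x)); rewrite iterD.
exists (j - k.+1)%N; first by move: jb => /=; lia.
change (A (iter (j - k.+1) left_shift (iter k.+1 left_shift x))).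
by rewrite -iterD subnK//; move: jb => /=; lia.
Qed.

Lemma window_gap k n g l : (k + (n + g) <= l)%N ->
  l.+1 = (l - k - n + (k.+1 + n))%N /\ (g <= l - k - n)%N.
Proof. by move=> kl; split; lia. Qed.

Section quenched_sums.
Context d (Omega : measurableType d) (R : realType).
Variables (P : probability Omega R) (mu_ : R.-pker Omega ~> symb).
Variables (mu : probability symb R) (y : symb).
Variables (h h0 c C0 Cp p q s0 : R) (C : Omega -> R) (alpha : nat -> R).

Let mu1 : mu setT = 1%E := probability_setT mu.
Let pr w (A : set symb) : R := fine (mu_ w A).
Let eps n : R := c * expR (- (h0 * n%:R)).

Hypothesis mu_mean : forall A : set symb, measurable A ->
  mu A = (\int[P]_w mu_ w A)%E.
Hypothesis shift_inv : forall k, invariant_measure (iter k left_shift) mu.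
Hypotheses (h0_gt0 : 0 < h0) (c_gt0 : 0 < c) (C0_gt0 : 0 < C0).
Hypotheses (p_gt0 : 0 < p) (p_le1 : p <= 1).
Hypothesis sample_up : forall n k, (0 < n)%N -> {ae P, forall w,
  fine (mu_ w (iter k left_shift @^-1` cylinder n y))
    <= c * expR (- (h0 * n%:R))}.
Hypothesis mixing : forall n l g A B, (0 < n)%N -> (0 < g)%N ->
  finitary n A -> finitary l B ->
  `|fine (mu (A `&` iter (g + n) left_shift @^-1` B))
    - fine (mu A) * fine (mu B)| <= C0 * alpha g.
Hypothesis sample_mixing : forall n l g A B, (0 < n)%N -> (0 < g)%N ->
  finitary n A -> finitary l B -> {ae P, forall w,
  `|fine (mu_ w (A `&` iter (g + n) left_shift @^-1` B))
    - fine (mu_ w A) * fine (mu_ w (iter (g + n) left_shift @^-1` B))|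
  <= C w * alpha g}.
Hypothesis alpha_ge0 : forall g, (0 < g)%N -> 0 <= alpha g.
Hypothesis alpha_le : forall (s : R) g, s0 <= s -> expR s <= g%:R ->
  alpha g <= expR (- (q * s)).
Hypothesis mC : measurable_fun setT C.
Hypothesis C_moment : (\int[P]_w (`|C w| `^ p)%:E <= Cp%:E)%E.

Let prk1 w : mu_ w setT = 1%E. Proof. exact: prob_kernel. Qed.

Lemma measurable_pr A : measurable A -> measurable_fun setT (fun w => pr w A).
Proof.
by move=> mA; apply: measurableT_comp => //; exact: measurable_kernel.
Qed.

Lemma integral_pr A : measurable A ->
  (\int[P]_w (pr w A)%:E = (fine (mu A))%:E)%E.
Proof.
move=> mA; transitivity (mu A); last exact: (prE mu1 mA).
transitivity (\int[P]_w mu_ w A)%E; last exact/esym/mu_mean.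
by apply: eq_integral => w _; rewrite [RHS](prE (prk1 w) mA).
Qed.

(** In the mixing bound the random constant [C] need not be integrable; but the
    left-hand side is at most 1, hence at most its own [p]-th power. *)
Lemma sample_correlation n (D : set symb) i g : (0 < n)%N -> (0 < g)%N ->
  finitary n D ->
  (\int[P]_w (pr w (iter i left_shift @^-1` D)
      * pr w (iter (g + (i + n)) left_shift @^-1` D))%:E <=
    (fine (mu D) ^+ 2 + (C0 * alpha g + Cp * alpha g `^ p))%:E)%E.
Proof.
move=> n0 g0 fD; set A := iter i left_shift @^-1` D.
set B := iter (g + (i + n)) left_shift @^-1` D.
have fA : finitary (i + n) A by exact: finitary_shift.
have mD := finitary_measurable fD.
have mA := finitary_measurable fA.
have mB : measurable B by exact: measurable_shift.
have mAB : measurable (A `&` B) by exact: measurableI.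
have in0 : (0 < i + n)%N by rewrite addn_gt0 n0 orbT.
have ag0 := alpha_ge0 g0.
have mCp : measurable_fun setT (fun w => (`|C w| `^ p * alpha g `^ p)%:E).
  apply/measurable_EFinP; apply: measurable_funM => //.
  apply: (@measurableT_comp _ _ _ _ _ _ (@powR R ^~ p)) => //.
  by apply: measurableT_comp.
have mC' : measurable_fun setT (fun w => (`|C w| `^ p)%:E).
  apply/measurable_EFinP.
  apply: (@measurableT_comp _ _ _ _ _ _ (@powR R ^~ p)) => //.
  by apply: measurableT_comp.
have mprAB : measurable_fun setT (fun w => (pr w (A `&` B))%:E).
  by apply/measurable_EFinP; exact: measurable_pr.
apply: (@le_trans _ _ (\int[P]_w ((pr w (A `&` B))%:E
    + (`|C w| `^ p * alpha g `^ p)%:E))%E).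
  apply: ae_ge0_le_integral => //.
  - by move=> w _; rewrite lee_fin mulr_ge0 ?pr_ge0.
  - by apply/measurable_EFinP; apply: measurable_funM; exact: measurable_pr.
  - by move=> w _; rewrite -EFinD lee_fin addr_ge0 ?pr_ge0 ?mulr_ge0 ?powR_ge0.
  - exact: emeasurable_funD.
  apply: filterS (sample_mixing in0 g0 fA fD) => w H _.
  rewrite -EFinD lee_fin -lerBlDl -/A -/B -/(pr w _) -/(pr w A) -/(pr w B) in H *.
  set x := _ - _; have [x0|x0] := leP x 0.
    by rewrite (le_trans x0)// mulr_ge0 ?powR_ge0.
  have x1 : x <= 1.
    rewrite /x lerBlDr -[leLHS]mul1r.
    rewrite (le_trans _ (_ : 1 * 1 <= _))//; last first.
      by rewrite mulr1 lerDl pr_ge0.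
    by rewrite mul1r ler_pM ?pr_ge0 ?pr_le1.
  have xC : x <= `|C w| * alpha g.
    apply: (@le_trans _ _ (C w * alpha g)); last by rewrite ler_wpM2r// ler_norm.
    by apply: le_trans H; rewrite distrC ler_norm.
  rewrite -powRM//; apply: (@le_trans _ _ (x `^ p)); last first.
    by apply: ge0_ler_powR; rewrite ?nnegrE ?(ltW p_gt0) ?(ltW x0) ?mulr_ge0.
  rewrite -[leLHS]powRr1 ?(ltW x0)//; apply: ger_powR => //.
  by rewrite x0.
rewrite ge0_integralD//; last 2 first.
- by move=> w _; rewrite lee_fin pr_ge0.
- by move=> w _; rewrite lee_fin mulr_ge0 ?powR_ge0.
rewrite (integral_pr mAB).
under [X in (_ + X)%E]eq_integral do rewrite mulrC EFinM.
rewrite ge0_integralZl//; last by rewrite lee_fin powR_ge0.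
have := mixing in0 g0 fA fD; rewrite -/A -/B => mix.
have muA : fine (mu A) = fine (mu D) by rewrite /A shift_inv.
apply: (@le_trans _ _ ((fine (mu (A `&` B)))%:E + (alpha g `^ p)%:E * Cp%:E)%E).
  by rewrite leeD2l// lee_wpmul2l// lee_fin powR_ge0.
rewrite -EFinM -EFinD lee_fin.
move: mix; rewrite muA ler_norml => /andP[_].
by rewrite expr2; lra.
Qed.

(** Correlations of the sums along the orbit: at distance [n' + g] and more,
    [alpha] is at most [expR (- (q * s))] by the choice of [g]; at shorter
    distance the uniform bound [eps n] is used. *)
Lemma window_second_moment n n' (D : set symb) N (s : R) :
  (0 < n)%N -> (0 < n')%N -> finitary n' D -> D `<=` cylinder n y ->
  s0 <= s -> 0 <= q * s ->
  let g := (Num.truncn (expR s)).+1 in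
  (\int[P]_w ((\sum_(k < N) pr w (iter k.+1 left_shift @^-1` D)
      - N%:R * fine (mu D)) ^+ 2)%:E <=
   (2 * N%:R * (n' + g)%:R * eps n * fine (mu D)
    + N%:R ^+ 2 * ((C0 + Cp) * expR (- (q * p * s))))%:E)%E.
Proof.
move=> n0 n'0 fD DC ss qs; set g := (Num.truncn _).+1; cbv zeta.
have mD := finitary_measurable fD.
have mDk k : measurable (iter k left_shift @^-1` D) by exact: measurable_shift.
have Cp0 : 0 <= Cp.
  rewrite -lee_fin; apply: le_trans C_moment; apply: integral_ge0 => w _.
  by rewrite lee_fin powR_ge0.
apply: (@second_moment_window _ _ _ P
  (fun k w => pr w (iter k.+1 left_shift @^-1` D))).
- by move=> k; exact: measurable_pr.
- by move=> k w; exact: pr_ge0.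
- move=> k; apply: filterS (sample_up k.+1 n0) => w; apply: le_trans.
  apply: (le_pr (prk1 w)) => //.
    by apply: measurable_shift; exact: measurable_cylinder.
  by move=> x Dx; exact: DC.
- by move=> k; rewrite integral_pr// shift_inv.
- move=> k l /window_gap[lE gl].
  rewrite lE; have g'0 : (0 < l - k - n')%N := leq_trans (ltn0Sn _) gl.
  apply: le_trans (sample_correlation k.+1 n'0 g'0 fD) _.
  rewrite lee_fin lerD2l mulrDl.
  have al : alpha (l - k - n') <= expR (- (q * s)).
    apply: alpha_le => //; apply: (@le_trans _ _ g%:R).
      exact/ltW/truncnS_gt.
    by rewrite ler_nat.
  apply: lerD; rewrite ler_wpM2l ?(ltW C0_gt0)//.
    apply: le_trans al _; rewrite ler_expR lerN2 mulrAC ler_piMr//.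
  have -> : expR (- (q * p * s)) = expR (- (q * s)) `^ p.
    by rewrite -expRM; congr expR; ring.
  by apply: ge0_ler_powR; rewrite ?nnegrE ?(ltW p_gt0) ?alpha_ge0 ?expR_ge0.
- by rewrite mulr_ge0 ?expR_ge0// addr_ge0// ltW.
- by rewrite mulr_ge0 ?expR_ge0// ltW.
Qed.

Hypotheses (h_gt0 : 0 < h) (h0q : 4 * h < h0 * q) (h0qp : 3 * h < h0 * (q * p)).
Hypothesis y_gt0 : forall n, 0 < cyl_pr mu n y.
Hypothesis y_low : exists N, forall n, (N <= n)%N ->
  expR (- (9 / 8 * h * n%:R)) <= cyl_pr mu n y.
Hypothesis y_up : forall n, (0 < n)%N ->
  cyl_pr mu n y <= c * expR (- (h0 * n%:R)).

(** The exponent is a compromise: [alpha (gap n)] must be negligible against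
    the measure of the cylinder, for which [3 / 8 * h0 * q > 9 / 8 * h] is
    enough, while early returns are only known to be improbable up to times
    well below [expR (h0 * n)]. *)
Definition gap n : nat := (Num.truncn (expR (3 / 8 * h0 * n%:R))).+1.

Definition horizon (t : R) n : nat := Num.truncn (t / cyl_pr mu n y).

Lemma horizon_le t n : 0 <= t -> (horizon t n)%:R <= t / cyl_pr mu n y.
Proof. by move=> t0; rewrite truncn_le divr_ge0// ltW. Qed.

Lemma horizon_mu_le t n : 0 <= t -> (horizon t n)%:R * cyl_pr mu n y <= t.
Proof. by move=> t0; rewrite -ler_pdivlMr//; exact: horizon_le. Qed.

Lemma q_gt0 : 0 < q.
Proof. by rewrite -(pmulr_rgt0 _ h0_gt0); move: h0q h_gt0; lra. Qed.

Lemma truncnS_expR_le (x : R) : (Num.truncn (expR x)).+1%:R <= 1 + expR x.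
Proof. by rewrite -natr1 addrC lerD2l truncn_le expR_ge0. Qed.

(** With correlations cut at the gap [expR (3 / 4 * h0 * n)], the pairs inside
    the window cost about [expR (- h0 * n / 4)], and those outside about
    [expR (9 / 4 * h * n) * expR (- 3 / 4 * h0 * q * p * n)]. *)
Lemma sum_concentration (t : R) (n' : nat -> nat) (D : nat -> set symb) :
  0 <= t -> (forall n, (0 < n)%N -> (0 < n' n <= 2 * n + gap n)%N) ->
  (forall n, finitary (n' n) (D n)) -> (forall n, D n `<=` cylinder n y) ->
  {ae P, forall w, (fun n =>
    \sum_(k < horizon t n) pr w (iter k.+1 left_shift @^-1` D n)
    - (horizon t n)%:R * fine (mu (D n))) @ \oo --> (0 : R)}.
Proof.
move=> t0 n'P fD DC; have [N1 hN1] := y_low.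
(* From [N2] on, [3 / 4 * h0 * n] is in the range where [alpha] is controlled. *)
pose N2 := (Num.truncn (s0 / (3 / 4 * h0))).+1.
pose N := (maxn N1 N2).+1.
pose X n w := \sum_(k < horizon t n) pr w (iter k.+1 left_shift @^-1` D n)
    - (horizon t n)%:R * fine (mu (D n)).
suff : {ae P, forall w, (fun n => X (n + N)%N w) @ \oo --> (0 : R)}.
  by apply: filterS => w; rewrite (cvg_shiftn N (X ^~ w)).
pose rho := Num.min (h0 / 8) (3 / 4 * (h0 * (q * p)) - 9 / 4 * h).
have rho0 : 0 < rho.
  by rewrite lt_min divr_gt0//=; move: h0qp; lra.
have Cp0 : 0 <= Cp.
  rewrite -lee_fin; apply: le_trans C_moment; apply: integral_ge0 => w _.
  by rewrite lee_fin powR_ge0.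
have CC0 : 0 <= C0 + Cp by rewrite addr_ge0// ltW.
pose K1 := 2 * t * c * (2 * (h0 / 8)^-1 + 4).
pose K2 := t ^+ 2 * (C0 + Cp).
have K20 : 0 <= K2 by rewrite mulr_ge0 ?sqr_ge0.
have tc0 : 0 <= 2 * t * c by rewrite !mulr_ge0// ltW.
have K10 : 0 <= K1.
  by rewrite mulr_ge0// addr_ge0// mulr_ge0// invr_ge0 divr_ge0// ltW.
have r01 : 0 <= expR (- rho) < 1 by rewrite expR_ge0 expR_lt1 oppr_lt0.
apply: (@ae_cvg0_second_moment _ _ _ P (fun n => X (n + N)%N)
   (fun n => (K1 + K2) * expR (- rho) ^+ n) ((K1 + K2) * (1 - expR (- rho))^-1)).
- move=> n; apply: measurable_funB => //; apply: measurable_sum => k.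
  apply: measurable_pr; apply: measurable_shift.
  exact: finitary_measurable (fD _).
- move=> n0; set n := (n0 + N)%N.
  have n_gt0 : (0 < n)%N by rewrite /n /N addnS.
  have Nn : (maxn N1 N2 <= n)%N := ltnW (leq_addl n0 N).
  have nN1 : (N1 <= n)%N := leq_trans (leq_maxl _ _) Nn.
  have nN2 : (N2 <= n)%N := leq_trans (leq_maxr _ _) Nn.
  pose s := 3 / 4 * h0 * n%:R.
  have h340 : 0 < 3 / 4 * h0 by rewrite mulr_gt0.
  have s0s : s0 <= s.
    rewrite /s mulrC -ler_pdivrMr//; apply: (@le_trans _ _ N2%:R).
      exact/ltW/truncnS_gt.
    by rewrite ler_nat.
  have s_ge0 : 0 <= s by rewrite /s mulr_ge0// ltW.
  have qs : 0 <= q * s by rewrite mulr_ge0// ltW// q_gt0.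
  have /andP[n'0 n'le] := n'P _ n_gt0.
  apply: le_trans (window_second_moment (horizon t n) n_gt0 n'0 (fD n) (DC n) s0s qs) _.
  rewrite /= lee_fin.
  pose E := expR s.
  have E1 : 1 <= E by rewrite expR_ge1.
  have gapE : (gap n)%:R <= 1 + E.
    rewrite (le_trans (truncnS_expR_le _))// lerD2l ler_expR /s.
    by rewrite ler_wpM2r// ler_wpM2r ?(ltW h0_gt0)//; lra.
  have win : (n' n + (Num.truncn (expR s)).+1)%:R <= (2 * n%:R + 4) * E.
    apply: (@le_trans _ _ (2 * n%:R + 2 + 2 * E)).
      have : (n' n)%:R <= 2 * n%:R + (gap n)%:R :> R.
        by rewrite -natrM -natrD ler_nat.
      by rewrite natrD; have := truncnS_expR_le s; rewrite -/E; lra.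
    rewrite mulrDl; have : 2 * n%:R * 1 <= 2 * n%:R * E by rewrite ler_wpM2l.
    by move: E1; lra.
  have muD : (horizon t n)%:R * fine (mu (D n)) <= t.
    apply: le_trans (horizon_mu_le n t0); rewrite ler_wpM2l//; apply: le_pr => //.
      exact: finitary_measurable (fD n).
    exact: measurable_cylinder.
  have rhoE (x : R) : rho <= x -> expR (- (x * n%:R)) <= expR (- rho) ^+ n0.
    move=> rx; rewrite -expRM_natr ler_expR mulNr lerN2.
    apply: ler_pM => //; first exact: ltW.
    by rewrite ler_nat /n leq_addr.
  rewrite [leRHS]mulrDl; apply: lerD.
    have -> : 2 * (horizon t n)%:R * (n' n + (Num.truncn (expR s)).+1)%:R
        * eps n * fine (mu (D n)) = 2 * ((horizon t n)%:R * fine (mu (D n)))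
        * ((n' n + (Num.truncn (expR s)).+1)%:R * eps n) by ring.
    apply: (@le_trans _ _ (2 * t * ((2 * n%:R + 4) * E * eps n))).
      apply: ler_pM => //.
      - by rewrite !mulr_ge0 ?pr_ge0.
      - by rewrite mulr_ge0// mulr_ge0 ?expR_ge0// ltW.
      - by rewrite ler_wpM2l.
      - by rewrite ler_wpM2r// mulr_ge0 ?expR_ge0// ltW.
    have EE : E * eps n = c * (expR (- (h0 / 8 * n%:R)) * expR (- (h0 / 8 * n%:R))).
      rewrite /E /eps mulrCA -!expRD; congr (c * expR _); rewrite /s; lra.
    rewrite -mulrA -[_ * E * _]mulrA EE.
    set e := expR _.
    have e1 : e <= expR (- rho) ^+ n0 by apply: rhoE; rewrite ge_min lexx.
    have e0 : 0 <= e := expR_ge0 _.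
    have e_le1 : e <= 1 by rewrite expR_le1 oppr_le0 mulr_ge0// divr_ge0// ltW.
    have ne : n%:R * e <= (h0 / 8)^-1 by apply: mul_expRN_le; rewrite divr_gt0.
    have -> : 2 * (t * ((2 * n%:R + 4) * (c * (e * e)))) =
      2 * t * c * (2 * (n%:R * e) + 4 * e) * e by ring.
    rewrite /K1; apply: ler_pM => //.
      by rewrite mulr_ge0// addr_ge0// mulr_ge0// mulr_ge0.
    by rewrite ler_wpM2l//; lra.
  have Nt : (horizon t n)%:R <= t * expR (9 / 8 * h * n%:R).
    apply: le_trans (horizon_le n t0) _; rewrite ler_wpM2l//.
    rewrite -[leRHS]invrK lef_pV2 ?posrE ?invr_gt0 ?expR_gt0//.
    by rewrite -expRN; exact: hN1.
  apply: (@le_trans _ _ ((t * expR (9 / 8 * h * n%:R)) ^+ 2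
     * ((C0 + Cp) * expR (- (q * p * s))))).
    rewrite ler_wpM2r ?mulr_ge0 ?expR_ge0// lerXn2r ?nnegrE//.
    by rewrite mulr_ge0 ?expR_ge0.
  rewrite exprMn -(expRM_natl 2).
  have -> : t ^+ 2 * expR (2%:R * (9 / 8 * h * n%:R)) *
      ((C0 + Cp) * expR (- (q * p * s))) = K2 *
      (expR (2%:R * (9 / 8 * h * n%:R)) * expR (- (q * p * s))) by rewrite /K2; ring.
  rewrite ler_wpM2l// -expRD.
  have -> : 2%:R * (9 / 8 * h * n%:R) - q * p * s =
      - ((3 / 4 * (h0 * (q * p)) - 9 / 4 * h) * n%:R) by rewrite /s; lra.
  by apply: rhoE; rewrite ge_min lexx orbT.
- by move=> n; rewrite -mulr_sumr ler_wpM2l ?addr_ge0// sum_geometric_le.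
Qed.

Let G n : nat := (n + gap n)%N.

Hypothesis y_short : forall e, 0 < e -> exists N, forall n, (N <= n)%N ->
  fine (mu (short_return G n y)) <= e * cyl_pr mu n y.

Lemma horizon_mu_cvg t : 0 <= t ->
  (fun n => (horizon t n)%:R * cyl_pr mu n y) @ \oo --> t.
Proof.
move=> t0; have eps0 : eps @ \oo --> (0 : R).
  by rewrite -[0](mulr0 c); apply: cvgM; [exact: cvg_cst|exact: cvg_expRN0].
suff H : (fun n => t - (horizon t n)%:R * cyl_pr mu n y) @ \oo --> (0 : R).
  apply: (cvg_eq (cvgB (cvg_cst t) H)); last by rewrite subr0.
  by move=> n /=; rewrite opprB addrCA subrr addr0.
apply: (cvg0_squeeze (N := 1%N) _ eps0) => n n0.
rewrite subr_ge0 horizon_mu_le//=.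
apply: le_trans (y_up n0); rewrite lerBlDr.
have := truncnS_gt (t / cyl_pr mu n y); rewrite ltr_pdivrMr// => /ltW.
by rewrite -/(horizon t n) -natr1 mulrDl mul1r addrC.
Qed.

Lemma eps_ge0 n : 0 <= eps n.
Proof. by rewrite mulr_ge0 ?expR_ge0// ltW. Qed.

Lemma early_window_cvg0 : (fun n => ((G n)%:R + 1) * eps n) @ \oo --> (0 : R).
Proof.
have h02 : 0 < h0 / 2 by rewrite divr_gt0.
have : (fun n : nat => c * (2 / h0 + 3) * expR (- (h0 / 8 * n%:R))) @ \oo --> (0 : R).
  rewrite -[0](mulr0 (c * (2 / h0 + 3))); apply: cvgM; first exact: cvg_cst.
  by apply: cvg_expRN0; rewrite divr_gt0.
apply: (cvg0_squeeze (N := 0%N)) => n _; apply/andP; split.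
  by rewrite mulr_ge0 ?addr_ge0// eps_ge0.
rewrite /G natrD; set E := expR (3 / 8 * h0 * n%:R).
have E1 : 1 <= E by rewrite expR_ge1// !mulr_ge0// ltW.
have gE : n%:R + (gap n)%:R + 1 <= (n%:R + 3) * E.
  have := truncnS_expR_le (3 / 8 * h0 * n%:R); rewrite -/(gap n) -/E.
  have : n%:R * 1 <= n%:R * E by rewrite ler_wpM2l.
  by rewrite mulrDl; lra.
apply: (@le_trans _ _ ((n%:R + 3) * E * eps n)).
  by rewrite ler_wpM2r// eps_ge0.
set e := expR (- (h0 / 2 * n%:R)); set e' := expR (- (h0 / 8 * n%:R)).
have -> : (n%:R + 3) * E * eps n = c * (n%:R * e + 3 * e) * e'.
  have EE : E * expR (- (h0 * n%:R)) = e * e'.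
    by rewrite /E /e /e' -!expRD; congr expR; lra.
  by rewrite /eps; transitivity ((n%:R + 3) * c * (E * expR (- (h0 * n%:R))));
    [ring|rewrite EE; ring].
rewrite ler_wpM2r ?expR_ge0// ler_wpM2l ?(ltW c_gt0)//.
have ne : n%:R * e <= (h0 / 2)^-1 by exact: mul_expRN_le.
have e1 : e <= 1 by rewrite expR_le1 oppr_le0 mulr_ge0// ltW.
by rewrite invf_div in ne; lra.
Qed.

Lemma horizon_alpha_cvg0 t : 0 <= t ->
  (fun n => (horizon t n)%:R * alpha (gap n)) @ \oo --> (0 : R).
Proof.
move=> t0; have [N1 hN1] := y_low.
pose N2 := (Num.truncn (s0 / (3 / 8 * h0))).+1.
pose rho := 3 / 8 * (h0 * q) - 9 / 8 * h.
have rho0 : 0 < rho by rewrite /rho; move: h0q h_gt0; lra.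
have : (fun n : nat => t * expR (- (rho * n%:R))) @ \oo --> (0 : R).
  by rewrite -[0](mulr0 t); apply: cvgM; [exact: cvg_cst|exact: cvg_expRN0].
apply: (cvg0_squeeze (N := maxn N1 N2)) => n nN.
have nN1 : (N1 <= n)%N := leq_trans (leq_maxl _ _) nN.
have nN2 : (N2 <= n)%N := leq_trans (leq_maxr _ _) nN.
rewrite mulr_ge0 ?alpha_ge0//=.
have h380 : 0 < 3 / 8 * h0 by rewrite mulr_gt0.
have al : alpha (gap n) <= expR (- (q * (3 / 8 * h0 * n%:R))).
  apply: alpha_le; last exact/ltW/truncnS_gt.
  rewrite mulrC -ler_pdivrMr//; apply: (@le_trans _ _ N2%:R).
    exact/ltW/truncnS_gt.
  by rewrite ler_nat.
have Nt : (horizon t n)%:R <= t * expR (9 / 8 * h * n%:R).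
  apply: le_trans (horizon_le n t0) _; rewrite ler_wpM2l//.
  rewrite -[leRHS]invrK lef_pV2 ?posrE ?invr_gt0 ?expR_gt0//.
  by rewrite -expRN; exact: hN1.
apply: (@le_trans _ _ (t * expR (9 / 8 * h * n%:R) *
    expR (- (q * (3 / 8 * h0 * n%:R))))).
  by apply: ler_pM => //; exact: alpha_ge0.
by rewrite -mulrA -expRD ler_wpM2l// ler_expR /rho; lra.
Qed.

Lemma horizon_short_cvg0 t : 0 <= t ->
  (fun n => (horizon t n)%:R * fine (mu (short_return G n y))) @ \oo --> (0 : R).
Proof.
move=> t0; apply/cvgrPdist_le => e e0.
have e1 : 0 < e / (t + 1) by rewrite divr_gt0// ltr_wpDl.
have [N hN] := y_short e1; exists N => // n /= nN.
rewrite sub0r normrN ger0_norm ?mulr_ge0 ?pr_ge0//.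
apply: (@le_trans _ _ ((horizon t n)%:R * (e / (t + 1) * cyl_pr mu n y))).
  by rewrite ler_wpM2l// hN.
rewrite mulrCA; apply: (@le_trans _ _ (e / (t + 1) * t)).
  by rewrite ler_wpM2l ?(ltW e1)// horizon_mu_le.
by rewrite mulrAC ler_pdivrMr ?ltr_wpDl// ler_wpM2l ?(ltW e0)// lerDl.
Qed.

(** The number of hits up to [horizon t n] has conditional mean close to [t] for
    almost every fibre, and clusters of hits have negligible mean, both by
    [sum_concentration]; then [avoidance_probability] applies in the fibre. *)
Lemma hitting_law (t : R) : 0 <= t ->
  {ae P, forall w, (fun n => fine (mu_ w [set x |
      ((t / cyl_pr mu n y)%:E < hitting_time R x (cylinder n y))%E]))
    @ \oo --> expR (- t)}.
Proof.
move=> t0.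
pose E n j : set symb := iter j left_shift @^-1` cylinder n y.
have fE n j : finitary (j + n) (E n j).
  by apply: finitary_shift; exact: finitary_cylinder.
have mE n j : measurable (E n j) := finitary_measurable (fE n j).
pose later n k : set symb :=
  ~` \bigcup_(i in [set i | (i < horizon t n - (k + G n))%N]) E n i.
have flater n k : finitary (horizon t n + n) (later n k).
  apply: finitaryC; apply: finitary_bigcup => i /= iN.
  apply: finitary_le (fE n i); rewrite leq_add2r.
  exact: leq_trans (ltnW iN) (leq_subr _ _).
have gap0 n : (0 < gap n)%N by [].
have up : {ae P, forall w, forall n k, (0 < n)%N -> pr w (E n k) <= eps n}.
  apply: ae_foralln => n; apply: ae_foralln => k.
  case: n => [|n]; first by apply: aeW.
  by apply: filterS (sample_up k (ltn0Sn n)).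
have mix : {ae P, forall w, forall n k, (0 < n)%N ->
    `|pr w (E n k.+1 `&` iter (gap n + (k.+1 + n)) left_shift @^-1` later n k)
      - pr w (E n k.+1) * pr w (iter (gap n + (k.+1 + n)) left_shift @^-1` later n k)|
    <= C w * alpha (gap n)}.
  apply: ae_foralln => n; apply: ae_foralln => k.
  have kn0 : (0 < k.+1 + n)%N by [].
  by apply: filterS (sample_mixing kn0 (gap0 n) (fE n k.+1) (flater n k)).
have conc : {ae P, forall w, (fun n => \sum_(k < horizon t n) pr w (E n k.+1)
    - (horizon t n)%:R * cyl_pr mu n y) @ \oo --> (0 : R)}.
  apply: (@sum_concentration t id (fun n => cylinder n y)) => [//|n n0|n|n x //].
    by rewrite n0 mul2n -addnn -addnA leq_addr.
  exact: finitary_cylinder.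
have conc' : {ae P, forall w, (fun n => \sum_(k < horizon t n)
    pr w (iter k.+1 left_shift @^-1` short_return G n y)
    - (horizon t n)%:R * fine (mu (short_return G n y))) @ \oo --> (0 : R)}.
  apply: (@sum_concentration t (fun n => n + G n)%N) => [//|n n0|n|n x [] //].
    by rewrite /G addn_gt0 n0 addnA addnn mul2n leqnn.
  exact: finitary_short_return.
apply: filterS (filterI (filterI up mix) (filterI conc conc')) => w.
move=> [[{}up {}mix] [{}conc {}conc']].
pose X n := \sum_(k < horizon t n) pr w (E n k.+1).
pose S n := \sum_(k < horizon t n)
  pr w (iter k.+1 left_shift @^-1` short_return G n y).
have X_t : X @ \oo --> t.
  apply: (cvg_eq (cvgD conc (horizon_mu_cvg t0))); last by rewrite add0r.
  by move=> n /=; rewrite subrK.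
have S_0 : S @ \oo --> (0 : R).
  apply: (cvg_eq (cvgD conc' (horizon_short_cvg0 t0))); last by rewrite add0r.
  by move=> n /=; rewrite subrK.
have NC_0 : (fun n => `|C w| * ((horizon t n)%:R * alpha (gap n))) @ \oo --> (0 : R).
  by rewrite -[0](mulr0 `|C w|); apply: cvgM; [exact: cvg_cst|exact: horizon_alpha_cvg0].
have GX_0 : (fun n => ((G n)%:R + 1) * eps n * X n) @ \oo --> (0 : R).
  by rewrite -[0](mul0r t); apply: cvgM; [exact: early_window_cvg0|exact: X_t].
have bound_0 : (fun n => S n + `|C w| * ((horizon t n)%:R * alpha (gap n))
    + ((G n)%:R + 1) * eps n * X n) @ \oo --> (0 : R).
  by apply: (cvg_eq (cvgD (cvgD S_0 NC_0) GX_0)) => //; rewrite !addr0.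
pose v n := pr w (avoid (E n) (horizon t n) 0).
have vE n : fine (mu_ w [set x |
    ((t / cyl_pr mu n y)%:E < hitting_time R x (cylinder n y))%E]) = v n.
  by rewrite hitting_time_gtE// divr_ge0// ltW.
have diff_0 : (fun n => v n - expR (- X n)) @ \oo --> (0 : R).
  suff : (fun n => `|v n - expR (- X n)|) @ \oo --> (0 : R) by move/norm_cvg0.
  apply: (cvg0_squeeze (N := 1%N) _ bound_0) => n n0.
  rewrite normr_ge0 /=.
  have e0 := eps_ge0 n.
  have G0 : (0 < G n)%N by rewrite /G addn_gt0 n0.
  have -> : `|C w| * ((horizon t n)%:R * alpha (gap n)) =
      (horizon t n)%:R * (`|C w| * alpha (gap n)) by ring.
  apply: (avoidance_probability (prk1 w) (mE n)
    (s := fun k => pr w (iter k.+1 left_shift @^-1` short_return G n y)) G0 e0).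
  - by rewrite mulr_ge0 ?alpha_ge0.
  - by move=> k; exact: up.
  - move=> k kN kGN.
    have -> : avoid (E n) (horizon t n) (k + G n) =
        iter (gap n + (k.+1 + n)) left_shift @^-1` later n k.
      have -> : (gap n + (k.+1 + n) = (k + G n).+1)%N.
        by rewrite addnC -addnA addSn.
      exact: avoid_preimage.
    apply: le_trans (mix n k n0) _.
    by rewrite ler_wpM2r ?alpha_ge0// ler_norm.
  - move=> k kN; apply: (le_pr (prk1 w)).
    + by apply: measurableI; [|apply: bigcup_measurable => i _].
    + apply: (@measurable_shift k.+1); apply: finitary_measurable.
      exact: (@finitary_short_return G n y).
    move=> x [Ex [i /= iG Ei]]; split=> //; exists i => //=.
    change (cylinder n y (iter i left_shift (iter k.+1 left_shift x))).
    by rewrite -iterD addnC.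
have exp_t : (fun n => expR (- X n)) @ \oo --> expR (- t).
  by apply: continuous_cvg; [exact: continuous_expR|exact: cvgN X_t].
apply: (cvg_eq (cvgD diff_0 exp_t)); last by rewrite add0r.
by move=> n /=; rewrite vE subrK.
Qed.

End quenched_sums.

(** * The exponential law *)

Lemma ae_invariant d (T : measurableType d) (R : realType)
    (P : {measure set T -> \bar R}) (S : T -> T) (Q : T -> Prop) :
  measurable_fun setT S -> invariant_measure S P ->
  {ae P, forall w, Q w} -> {ae P, forall w, Q (S w)}.
Proof.
move=> mS inv [B [mB B0 QB]]; exists (S @^-1` B); split.
- by rewrite -[X in measurable X]setTI; exact: mS.
- by rewrite -B0; exact: inv.
- by move=> w nQ; exact: (QB (S w)).
Qed.

(** The value at [t] is squeezed between those at the neighbouring multiples of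
    [j.+1%:R^-1]; [expR (- t)] is 1-Lipschitz on the nonnegative reals. *)
Lemma cvg_expRN_rational (R : realType) (F : R -> nat -> R) :
  (forall s t n, 0 <= s -> s <= t -> F t n <= F s n) ->
  (forall i j : nat, F (i%:R / j.+1%:R) @ \oo --> expR (- (i%:R / j.+1%:R))) ->
  forall t, 0 <= t -> F t @ \oo --> expR (- t).
Proof.
move=> Fle Fcvg t t0; apply/cvgrPdist_le => e e0.
have e2 : 0 < e / 2 by rewrite divr_gt0.
pose j := Num.truncn (e / 2)^-1; pose i := Num.truncn (t * j.+1%:R).
have j0 : 0 < j.+1%:R :> R by rewrite ltr0n.
have je : j.+1%:R^-1 <= e / 2.
  by rewrite -[leRHS]invrK lef_pV2 ?posrE ?invr_gt0//; exact/ltW/truncnS_gt.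
have tj0 : 0 <= t * j.+1%:R by rewrite mulr_ge0.
have /andP[lo hi] := truncn_itv tj0; rewrite -/i in lo hi.
pose s1 : R := i%:R / j.+1%:R; pose s2 : R := i.+1%:R / j.+1%:R.
have s10 : 0 <= s1 by rewrite divr_ge0.
have s1t : s1 <= t by rewrite ler_pdivrMr.
have ts2 : t <= s2 by rewrite ler_pdivlMr// ltW.
have s12 : s2 = s1 + j.+1%:R^-1 by rewrite /s1 /s2 -natr1 mulrDl mul1r.
have lip (a b : R) : 0 <= a -> a <= b ->
    expR (- b) <= expR (- a) /\ expR (- a) - expR (- b) <= b - a.
  move=> a0 ab; split; first by rewrite ler_expR lerN2.
  have -> : expR (- a) - expR (- b) = expR (- a) * (1 - expR (- (b - a))).
    by rewrite mulrBr mulr1 -expRD; congr (_ - expR _); ring.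
  have h1 := expR_ge1Dx (- (b - a)).
  have h2 : expR (- a) <= 1 by rewrite expR_le1 oppr_le0.
  have h3 : 0 <= 1 - expR (- (b - a)).
    by rewrite subr_ge0 expR_le1 oppr_le0 subr_ge0.
  by apply: (@le_trans _ _ (1 - expR (- (b - a)))); [rewrite ler_piMl|lra].
have [l1 l1'] := lip _ _ s10 s1t; have [l2 l2'] := lip _ _ t0 ts2.
have s2e : s2 - s1 <= e / 2 by rewrite s12 addrC addKr.
have [N1 _ hN1] : \forall n \near \oo, `|expR (- s1) - F s1 n| <= e / 2.
  by move/cvgrPdist_le: (Fcvg i j); exact.
have [N2 _ hN2] : \forall n \near \oo, `|expR (- s2) - F s2 n| <= e / 2.
  by move/cvgrPdist_le: (Fcvg i.+1 j); exact.
exists (maxn N1 N2) => // n /= nN.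
have := hN1 n (leq_trans (leq_maxl _ _) nN); have := hN2 n (leq_trans (leq_maxr _ _) nN).
have F1 := Fle _ _ n s10 s1t; have F2 := Fle _ _ n t0 ts2.
rewrite /= !ler_norml => /andP[? ?] /andP[? ?].
by clear s12 lip lo hi; clearbody s1 s2; apply/andP; split; lra.
Qed.

Theorem theorem1 (R : realType) (d : measure_display)
  (Omega : measurableType d) (P : probability Omega R)
  (theta : Omega -> Omega) (b : Omega -> nat)
  (a : Omega -> nat -> nat -> bool)
  (nu : probability (Omega * symb)%type R)
  (mu_ : R.-pker Omega ~> symb) (mu : probability symb R)
  (h0 c C0 p q : R) (C : Omega -> R) (alpha : nat -> R)
  (htheta : invertible_ergodic P theta)
  (hA : random_transition_matrix P theta b a)
  (hnu : invariant_on_bundle P theta b a nu)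
  (hmu_ : sample_measures P theta b a nu mu_)
  (hmu : forall A : set symb, measurable A -> mu A = (\int[P]_w mu_ w A)%E)
  (h0_gt0 : 0 < h0) (h0_le : h0 <= subshift_entropy theta nu)
  (c_gt0 : 0 < c) (C0_gt0 : 0 < C0) (p_gt0 : 0 < p) (p_le1 : p <= 1)
  (hq : subshift_entropy theta nu / h0 * (1 + 3 / p) < q)
  (hC : C \in Lfun P p%:E)
  (halpha : (fun g : nat => alpha g * (g%:R `^ q)) @ \oo --> 0)
  (hI : forall (m n g : nat) (A B : set symb),
    (0 < m)%N -> (0 < n)%N -> (0 < g)%N -> cyl_sigma n A -> cyl_sigma m B ->
    (`|mu (A `&` iter (g + n) left_shift @^-1` B) - mu A * mu B|
      <= (C0 * alpha g)%:E)%E)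
  (hII : {ae P, forall w, forall (y : symb) (n : nat), (0 < n)%N ->
    (mu_ w (cylinder n y) <= (c * expR (- h0 * n%:R))%:E)%E})
  (hIII : forall (m n g : nat) (A B : set symb),
    (0 < m)%N -> (0 < n)%N -> (0 < g)%N -> cyl_sigma n A -> cyl_sigma m B ->
    {ae P, forall w,
      (`|mu_ w (A `&` iter (g + n) left_shift @^-1` B)
         - mu_ w A * mu_ (iter (n + g) theta w) B|
        <= (C w * alpha g)%:E)%E}) :
  {ae mu, forall y : symb, {ae P, forall w, forall t : R, 0 <= t ->
    (fun n : nat => mu_ w [set x : symb |
        ((t / fine (mu (cylinder n y)))%:E
          < hitting_time R x (cylinder n y))%E])
      @ \oo --> (expR (- t))%:E}}.
Proof.
have mu1 : mu setT = 1%E := probability_setT mu.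
have k1 w : mu_ w setT = 1%E := prob_kernel w.
case: htheta => mth [theta' [mth' thK thK']] invth _.
have iterth k := invariant_measure_iter k mth invth.
have mskew : measurable_fun setT (@skew_product _ Omega theta).
  apply: measurable_fun_pair.
    by apply: (measurableT_comp mth).
  by apply: (measurableT_comp measurable_left_shift).
have iterK k : cancel (iter k theta) (iter k theta').
  by elim: k => // k IH w; rewrite iterSr iterS thK IH.
have miter' k : measurable_fun setT (iter k theta').
  by elim: k => [|k IH]; [exact: measurable_id|apply: (measurableT_comp mth' IH)].
have skewE k : iter k (@skew_product _ Omega theta) =
    (fun z => (iter k theta z.1, iter k left_shift z.2)).
  by apply/funext => z; elim: k => [|k IH]; [case: z|rewrite iterS IH].
have eqv k A : measurable A ->
    {ae P, forall w, mu_ w (iter k left_shift @^-1` A) = mu_ (iter k theta w) A}.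
  move=> mA; apply: (sample_equivariant (iterth k).1 (miter' k) (iterK k)
    (iterth k).2 (measurable_iter_shift k) (nu := nu)) => //.
    by rewrite -skewE; case: (invariant_measure_iter k mskew (iob_invariant hnu)).
  exact: sm_disintegration hmu_.
have mk A : measurable A -> measurable_fun setT (fun w => mu_ w A).
  by move=> mA; exact: measurable_kernel.
have shift_inv k : invariant_measure (iter k left_shift) mu.
  move=> A mA; have msA := measurable_shift k mA.
  transitivity (\int[P]_w mu_ w (iter k left_shift @^-1` A))%E; first exact: hmu.
  transitivity (\int[P]_w mu_ (iter k theta w) A)%E.
    apply: ae_eq_integral => //.
    - exact: mk.
    - by apply: (measurableT_comp (mk _ mA)); case: (iterth k).
    - by apply: filterS (eqv k A mA).
  transitivity (\int[P]_w mu_ w A)%E; last exact/esym/hmu.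
  exact: (ge0_integral_invariant (iterth k).1 (iterth k).2 (mk _ mA)
    (fun w => measure_ge0 _ _)).
have nu_mu A : measurable A -> nu (setT `*` A) = mu A.
  move=> mA; transitivity (\int[P]_w mu_ w (xsection (setT `*` A) w))%E.
    by apply: (sm_disintegration hmu_); exact: measurableX.
  transitivity (\int[P]_w mu_ w A)%E; last exact/esym/hmu.
  by apply: eq_integral => w _; rewrite in_xsectionX// inE.
pose h := subshift_entropy theta nu.
have h_gt0 : 0 < h := lt_le_trans h0_gt0 h0_le.
have hq' : h * (1 + 3 / p) < h0 * q.
  by move: hq; rewrite -/h mulrAC ltr_pdivrMr// [q * _]mulrC.
(* Since [p <= 1] and [h0 <= h], the hypothesis on [q] gives the three bounds
   used below. *)
have p3 : 3 <= 3 / p by rewrite ler_pdivlMr// ler_piMr.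
have h0q : 4 * h < h0 * q.
  apply: le_lt_trans hq'; rewrite mulrC ler_wpM2l ?(ltW h_gt0)//; lra.
have h0qp : 3 * h < h0 * (q * p).
  have : h * (1 + 3 / p) * p < h0 * q * p by rewrite ltr_pM2r.
  have -> : h * (1 + 3 / p) * p = h * p + 3 * h by field; rewrite gt_eqF.
  by have := mulr_gt0 h_gt0 p_gt0; rewrite -!mulrA; lra.
have q4 : 4 < q.
  rewrite -(ltr_pM2l h0_gt0); apply: le_lt_trans h0q.
  by rewrite mulrC ler_wpM2l.
have q0 : 0 < q by lra.
(* The certain event, paired with itself, shows that the rate is nonnegative. *)
have alpha_ge0 g : (0 < g)%N -> 0 <= alpha g.
  move=> g0; rewrite -(pmulr_rge0 _ C0_gt0) -lee_fin.
  have := hI 1%N 1%N g setT setT isT isT g0 (finitary_cyl_sigma (@finitaryT 1))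
    (finitary_cyl_sigma (@finitaryT 1)).
  by apply: le_trans; exact: abse_ge0.
have [N0 _ hN0] : \forall g \near \oo, `|0 - alpha g * g%:R `^ q| < 1.
  by move/cvgrPdist_lt: halpha; apply.
have alpha_pow g : (N0 <= g)%N -> alpha g * g%:R `^ q <= 1.
  by move=> /hN0 /=; rewrite sub0r normrN => /ltW; apply: le_trans; exact: ler_norm.
have alpha_le (s : R) g : N0%:R <= s -> expR s <= g%:R ->
    alpha g <= expR (- (q * s)).
  move=> Ns sg; have Ng : (N0 <= g)%N.
    rewrite -(ler_nat R) (le_trans Ns)// (le_trans _ sg)//.
    by rewrite (le_trans _ (expR_ge1Dx _))// lerDr.
  have g0 : (0 < g)%N by rewrite -(ltr_nat R); exact: lt_le_trans (expR_gt0 _) sg.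
  rewrite expRN -[leRHS]mul1r ler_pdivlMr ?expR_gt0//.
  apply: le_trans (alpha_pow g Ng); rewrite ler_wpM2l ?alpha_ge0//.
  rewrite mulrC expRM; apply: ge0_ler_powR; rewrite ?nnegrE ?expR_ge0//.
  exact: ltW.
have del_le g : (N0 <= g)%N -> (0 < g)%N -> C0 * alpha g <= C0 / g%:R ^+ 4.
  move=> Ng g0; rewrite ler_wpM2l ?(ltW C0_gt0)//.
  have g0R : 0 < g%:R :> R by rewrite ltr0n.
  rewrite -[leRHS]mul1r ler_pdivlMr ?exprn_gt0//.
  apply: le_trans (alpha_pow g Ng); rewrite ler_wpM2l ?alpha_ge0//.
  by rewrite -powR_mulrn//; apply: ler_powR; [rewrite ler1n|exact: ltW].
have mixing n l g A B : (0 < n)%N -> (0 < g)%N -> finitary n A -> finitary l B ->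
    `|fine (mu (A `&` iter (g + n) left_shift @^-1` B))
      - fine (mu A) * fine (mu B)| <= C0 * alpha g.
  move=> n0 g0 fA fB; have fB' : finitary l.+1 B by apply: finitary_le fB.
  have mA := finitary_measurable fA; have mB := finitary_measurable fB.
  have := hI l.+1 n g A B isT n0 g0 (finitary_cyl_sigma fA) (finitary_cyl_sigma fB').
  have mAB : measurable (A `&` iter (g + n) left_shift @^-1` B).
    by apply: measurableI => //; exact: measurable_shift.
  by rewrite (prE mu1 mA) (prE mu1 mB) (prE mu1 mAB) -EFinM -EFinB abse_EFin lee_fin.
have sample_mixing n l g A B : (0 < n)%N -> (0 < g)%N ->
    finitary n A -> finitary l B -> {ae P, forall w,
    `|fine (mu_ w (A `&` iter (g + n) left_shift @^-1` B))
      - fine (mu_ w A) * fine (mu_ w (iter (g + n) left_shift @^-1` B))|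
    <= C w * alpha g}.
  move=> n0 g0 fA fB; have fB' : finitary l.+1 B by apply: finitary_le fB.
  have mA := finitary_measurable fA; have mB := finitary_measurable fB.
  have mSB := measurable_shift (g + n) mB.
  have mAB : measurable (A `&` iter (g + n) left_shift @^-1` B).
    exact: measurableI.
  have H := hIII l.+1 n g A B isT n0 g0 (finitary_cyl_sigma fA) (finitary_cyl_sigma fB').
  apply: filterS2 H (eqv (g + n)%N B mB) => w + Ew.
  rewrite [(n + g)%N]addnC -Ew (prE (k1 w) mA) (prE (k1 w) mAB) (prE (k1 w) mSB).
  by rewrite -EFinM -EFinB abse_EFin lee_fin.
have sample_up y n k : (0 < n)%N -> {ae P, forall w,
    fine (mu_ w (iter k left_shift @^-1` cylinder n y)) <= c * expR (- (h0 * n%:R))}.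
  move=> n0; have mC := measurable_cylinder n y.
  have H := ae_invariant (iterth k).1 (iterth k).2 hII.
  apply: filterS2 H (eqv k _ mC) => w /(_ y n n0) + Ew.
  rewrite -Ew (prE (k1 w) (measurable_shift k mC)) lee_fin.
  by rewrite mulNr.
have cyl_up n y : (0 < n)%N -> cyl_pr mu n y <= c * expR (- (h0 * n%:R)).
  move=> n0; rewrite -lee_fin -(prE mu1 (measurable_cylinder _ _)).
  apply: (@le_trans _ _ (\int[P]_w mu_ w (cylinder n y))%E).
    by rewrite le_eqVlt; apply/orP; left; apply/eqP; exact: (hmu _ (measurable_cylinder n y)).
  rewrite -(integral_prob_cst P); apply: ae_ge0_le_integral => //.
  - by apply: mk; exact: measurable_cylinder.
  - by move=> w _; rewrite lee_fin mulr_ge0 ?expR_ge0// ltW.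
  - by apply: filterS hII => w H _; rewrite -mulNr; exact: H.
(* The entropy is positive, so the limit that defines it exists. *)
have [k k0 Hk] : exists2 k, (0 < k)%N &
    (block_entropy nu (skew_product theta) (fun z => z.2 0%N) k
      < (17 / 16 * h * k%:R)%:E)%E.
  have [N hN] : exists N, forall n, (N <= n)%N ->
      (block_entropy nu (skew_product theta) (fun z => z.2 0%N) n * (n%:R^-1)%:E
       < (17 / 16 * h)%:E)%E.
    apply: fine_limn_neq0_lt; first exact: lt0r_neq0 h_gt0.
    by change (h < 17 / 16 * h); lra.
  exists N.+1 => //; have := hN N.+1 (leqnSn N).
  by rewrite lte_pdivrMr ?ltr0n// -EFinM.
rewrite -(integral_ln_cyl_pr theta nu_mu) in Hk.
have k0R : 0 < k%:R :> R by rewrite ltr0n.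
have kh : 17 / 16 * h * k%:R < 9 / 8 * h * k%:R.
  by rewrite ltr_pM2r//; move: h_gt0; lra.
have del0 : (fun g => C0 * alpha g) @ \oo --> (0 : R).
  apply: (cvg0_squeeze (N := N0.+1) (b := fun g => C0 * 2 * g.+1%:R^-1)) => [g Ng|].
    have g0 : (0 < g)%N := leq_trans (ltn0Sn N0) Ng.
    rewrite mulr_ge0 ?alpha_ge0 ?(ltW C0_gt0)//=.
    apply: le_trans (del_le g (ltnW Ng) g0) _.
    rewrite -mulrA ler_wpM2l ?(ltW C0_gt0)//.
    have g4 : 0 < g%:R ^+ 4 :> R by rewrite exprn_gt0// ltr0n.
    rewrite ler_pdivlMr// mulrC ler_pdivrMr// -natrX -natrM ler_nat.
    have gg : (g <= g ^ 4)%N by rewrite -{1}(expn1 g) leq_pexp2l.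
    rewrite mul2n -addnn (leq_trans _ (leq_add gg gg))//.
    by rewrite -addn1 leq_add2l.
  rewrite -[0](mulr0 (C0 * 2)); apply: cvgM; first exact: cvg_cst.
  exact: cvg_harmonic.
have lower := cyl_pr_lower_bound shift_inv k0 del0 mixing Hk kh.
pose G n := (n + gap h0 n)%N.
have G_le n : (G n)%:R <= (n%:R + 2) * expR (3 / 8 * h0 * n%:R).
  rewrite /G natrD; have := truncnS_expR_le (3 / 8 * h0 * n%:R).
  rewrite -/(gap h0 n); set E := expR _ => gE.
  have E1 : 1 <= E by rewrite expR_ge1// !mulr_ge0// ltW.
  have : n%:R * 1 <= n%:R * E by rewrite ler_wpM2l.
  by rewrite mulrDl; lra.
have G_homo : {homo G : n l / (n <= l)%N}.
  move=> n l nl; rewrite /G leq_add// ltnS le_truncn// ler_expR.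
  by rewrite ler_wpM2l ?ler_nat// mulr_ge0// ltW.
have short := short_return_negligible mixing h0_gt0 c_gt0
  (ltW C0_gt0) cyl_up del_le G_le G_homo.
have mC : measurable_fun setT C.
  by move: hC; rewrite inE => /andP[]; rewrite inE.
have Cfin : (\int[P]_w (`|C w| `^ p)%:E < +oo)%E.
  move: hC; rewrite inE => /andP[_]; rewrite inE /= /finite_norm unlock /Lnorm.
  by move=> /lty_poweRy; apply; rewrite invr_neq0// gt_eqF.
have Cnn : (0 <= \int[P]_w (`|C w| `^ p)%:E)%E.
  by apply: integral_ge0 => w _; rewrite lee_fin powR_ge0.
pose Cp := fine (\int[P]_w (`|C w| `^ p)%:E)%E.
have C_moment : (\int[P]_w (`|C w| `^ p)%:E <= Cp%:E)%E.
  by rewrite /Cp fineK// ge0_fin_numE.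
have law y t : (forall n, 0 < cyl_pr mu n y) ->
    (exists N, forall n, (N <= n)%N -> expR (- (9 / 8 * h * n%:R)) <= cyl_pr mu n y) ->
    (forall e, 0 < e -> exists N, forall n, (N <= n)%N ->
      fine (mu (short_return G n y)) <= e * cyl_pr mu n y) -> 0 <= t ->
    {ae P, forall w, (fun n => fine (mu_ w [set x |
        ((t / cyl_pr mu n y)%:E < hitting_time R x (cylinder n y))%E]))
      @ \oo --> expR (- t)}.
  move=> y0 ylow yshort t0.
  exact: (hitting_law hmu shift_inv h0_gt0 c_gt0 C0_gt0 p_gt0 p_le1 (sample_up y)
    mixing sample_mixing alpha_ge0 alpha_le mC C_moment h_gt0 h0q h0qp y0 ylow
    (fun n => cyl_up n y) yshort t0).
have pos := ae_cyl_pr_gt0 mu.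
apply: filterS3 pos lower short => y y0 ylow yshort.
have : {ae P, forall w, forall i j : nat, (fun n => fine (mu_ w [set x |
    ((i%:R / j.+1%:R / cyl_pr mu n y)%:E < hitting_time R x (cylinder n y))%E]))
  @ \oo --> expR (- (i%:R / j.+1%:R : R))}.
  apply: ae_foralln => i; apply: ae_foralln => j.
  by apply: law => //; rewrite divr_ge0.
apply: filterS => w Hw t t0.
have mH (s : R) n : 0 <= s -> measurable [set x : symb |
    ((s / cyl_pr mu n y)%:E < hitting_time R x (cylinder n y))%E].
  move=> s0; rewrite hitting_time_gtE; last by rewrite divr_ge0// cyl_pr_ge0.
  apply: measurable_avoid => j; apply: measurable_shift.
  exact: measurable_cylinder.
apply: cvg_EFin.
  by apply: nearW => n; rewrite (prE (k1 w) (mH _ n t0)).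
apply: (@cvg_expRN_rational _ (fun s n => fine (mu_ w [set x |
    ((s / cyl_pr mu n y)%:E < hitting_time R x (cylinder n y))%E]))) => //.
move=> s s' n s0 ss'; have s'0 := le_trans s0 ss'.
apply: (le_pr (k1 w)); [exact: mH|exact: mH|move=> x /=].
by apply: le_lt_trans; rewrite lee_fin ler_wpM2r// invr_ge0 cyl_pr_ge0.
Qed.
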